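(* Let $n\ge2$ and let $\Omega$ be a bounded domain of the hyperbolic space $\mathbb H^n$ with $C^1$ boundary. Then $\Omega$ admits at least $n$ strictly negative biharmonic Neumann eigenvalues (counted with multiplicity), i.e. $\mu_1\le\cdots\le\mu_n<0$.
   Context: $\mathbb H^n$ is the standard hyperbolic space of constant sectional curvature $-1$; a domain is a connected open set. $H^2(\Omega)$ is the completion of $C^\infty(\Omega)$ (functions with finite norm) with respect to $\left(\int_\Omega(|D^2f|^2+|\nabla f|^2+f^2)dv\right)^{1/2}$, with $D^2$ the Hessian and $dv$ the Riemannian volume element. The biharmonic Neumann eigenvalues $\mu_1\le\mu_2\le\cdots$ (repeated with multiplicity) are the eigenvalues of $\int_\Omega(\langle D^2u,D^2\phi\rangle+\mathrm{Ric}(\nabla u,\nabla\phi))dv=\mu\int_\Omega u\phi\,dv$ for all $\phi\in H^2(\Omega)$, with $u\in H^2(\Omega)$, $\mu\in\mathbb R$, that is $$\mu_j=\min_{\substack{U\subset H^2(\Omega)\\ \dim U=j}}\max_{0\ne u\in U}\frac{\int_\Omega(|D^2u|^2+\mathrm{Ric}(\nabla u,\nabla u))dv}{\int_\Omega u^2dv}.$$ *)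

(* Defs.v *)
From HB Require Import structures.
From mathcomp Require Import all_boot all_order all_algebra.
From mathcomp Require Import all_classical all_reals all_analysis.
Set Implicit Arguments.
Unset Strict Implicit.
Unset Printing Implicit Defensive.
Import Order.TTheory GRing.Theory Num.Theory.
Import numFieldNormedType.Exports.
Local Open Scope classical_set_scope.
Local Open Scope ring_scope.

Section product_tuple.
Context d (T : measurableType d) (R : realType).
Variable m1 : {sigma_finite_measure set T -> \bar R}.

Definition cons_pair n (p : T * n.-tuple T) : n.+1.-tuple T :=
  [tuple of p.1 :: p.2].

Lemma measurable_cons_pair n : measurable_fun [set: _] (@cons_pair n).
Proof. exact: measurable_cons. Qed.

Section step.
Variables (n : nat) (m2 : {sigma_finite_measure set (n.-tuple T) -> \bar R}).

Definition product_cons : set (n.+1.-tuple T) -> \bar R :=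
  pushforward (m1 \x m2)%E (@cons_pair n).

Let mcons (A : set (n.+1.-tuple T)) :
  measurable A -> measurable (@cons_pair n @^-1` A).
Proof.
by move=> mA; rewrite -[X in measurable X]setTI; exact: measurable_cons_pair.
Qed.

Let product_cons0 : product_cons set0 = 0%E.
Proof. by rewrite /product_cons /pushforward preimage_set0 measure0. Qed.

Let product_cons_ge0 A : (0 <= product_cons A)%E.
Proof. by rewrite /product_cons /pushforward; apply: measure_ge0. Qed.

Let product_cons_sigma_additive : semi_sigma_additive product_cons.
Proof.
move=> F mF tF mUF; rewrite /product_cons /pushforward preimage_bigcup.
apply: measure_semi_sigma_additive.
- by move=> k; exact: mcons.
- apply/trivIsetP => /= i j _ _ ij; rewrite -preimage_setI.
  by move/trivIsetP : tF => /(_ _ _ _ _ ij) ->//; rewrite preimage_set0.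
- by rewrite -preimage_bigcup; exact: mcons.
Qed.

HB.instance Definition _ := isMeasure.Build _ _ _ product_cons
  product_cons0 product_cons_ge0 product_cons_sigma_additive.

Let product_cons_sigma_finite : sigma_finite setT product_cons.
Proof.
have [F TF Foo] : sigma_finite setT (m1 \x m2)%E.
  have /sigma_finiteP[F [TF ndF Foo]] := sigma_finiteT m1.
  have /sigma_finiteP[G [TG ndG Goo]] := sigma_finiteT m2.
  exists (fun k => F k `*` G k).
    rewrite -setXTT TF TG predeqE => -[x y]; split.
      move=> [/= [k _ Fkx] [l _ Gly]]; exists (maxn k l) => //; split.
      - by move: x Fkx; exact/subsetPset/ndF/leq_maxl.
      - by move: y Gly; exact/subsetPset/ndG/leq_maxr.
    by move=> [k _ []/= ? ?]; split; exists k.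
  move=> k; have [? ?] := Foo k; have [? ?] := Goo k.
  split; first exact: measurableX.
  by rewrite product_measure1E// lte_mul_pinfty// ge0_fin_numE.
pose g (t : n.+1.-tuple T) : T * n.-tuple T := (thead t, [tuple of behead t]).
have gK (p : T * n.-tuple T) : g (cons_pair p) = p.
  case: p => x t; rewrite /g /cons_pair /= theadE; congr pair.
  exact: val_inj.
have mg : measurable_fun [set: n.+1.-tuple T] g.
  apply/measurable_fun_pairP; split; first exact: measurable_tnth.
  exact: measurable_behead.
exists (fun k => g @^-1` F k).
  by rewrite -preimage_bigcup -TF preimage_setT.
move=> k; have [mFk Fk] := Foo k; split.
  by rewrite -[X in measurable X]setTI; exact: mg.
rewrite /product_cons /pushforward -comp_preimage.
by rewrite (_ : g \o _ = id)//; apply/funext => p /=; exact: gK.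
Qed.

HB.instance Definition _ := Measure_isSigmaFinite.Build _ _ _ product_cons
  product_cons_sigma_finite.

End step.

(* the n-fold product measure of m1 *)
Fixpoint product_tuple n : {sigma_finite_measure set (n.-tuple T) -> \bar R} :=
  match n with
  | 0 => dirac ([tuple] : 0.-tuple T)
  | k.+1 => product_cons (product_tuple k)
  end.

End product_tuple.

Definition lebesgue_tuple (R : realType) (n : nat) :
    {sigma_finite_measure set (n.-tuple (measurableTypeR R)) -> \bar R} :=
  product_tuple (@lebesgue_measure R) n.

Section Riemannian.
Context {R : realType} {n : nat}.
Local Notation E := 'rV[R]_n.

Definition partial (i : 'I_n) (f : E -> R) (x : E) : R :=
  'D_(delta_mx 0 i) f x.

(* f is of class C^k on the open set U; f itself is a total function and its
   values outside U play no role. *)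
Fixpoint classC (k : nat) (U : set E) (f : E -> R) : Prop :=
  (forall x, U x -> {for x, continuous f}) /\
  match k with
  | 0 => True
  | l.+1 => forall i : 'I_n,
      (forall x, U x -> derivable f x (delta_mx 0 i)) /\
      classC l U (partial i f)
  end.

Definition smooth (U : set E) (f : E -> R) : Prop := forall k, classC k U f.

(* Riemannian geometry in a global chart: g x is the matrix (g_ij) of the
   metric at x in the coordinate frame. *)
Variable g : E -> 'M[R]_n.

(* Christoffel symbol Gamma^k_ij *)
Definition christoffel (k i j : 'I_n) (x : E) : R :=
  2^-1 * \sum_l invmx (g x) k l *
    (partial i (fun y => g y j l) x + partial j (fun y => g y i l) x
     - partial l (fun y => g y i j) x).

(* Ric_jk, with the sign for which round spheres have positive curvature *)
Definition ricci (x : E) : 'M[R]_n := \matrix_(j, k)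
  (\sum_i (partial i (christoffel i j k) x - partial j (christoffel i i k) x)
   + \sum_i \sum_p (christoffel i i p x * christoffel p j k x
                    - christoffel i j p x * christoffel p i k x)).

(* contravariant components of the gradient *)
Definition gradient (f : E -> R) (x : E) : 'rV[R]_n :=
  \row_i \sum_j invmx (g x) i j * partial j f x.

(* covariant Hessian (D^2 f)_ij *)
Definition hessian (f : E -> R) (x : E) : 'M[R]_n := \matrix_(i, j)
  (partial i (partial j f) x - \sum_k christoffel k i j x * partial k f x).

Definition bilin (A : 'M[R]_n) (v w : 'rV[R]_n) : R :=
  \sum_i \sum_j A i j * v 0 i * w 0 j.

(* inner product g^ik g^jl A_ij B_kl of covariant 2-tensors *)
Definition tensor2 (x : E) (A B : 'M[R]_n) : R :=
  \sum_i \sum_j \sum_k \sum_l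
    invmx (g x) i k * invmx (g x) j l * A i j * B k l.

Definition riemann_integral (Omega : set E) (F : E -> R) : \bar R :=
  (\int[lebesgue_tuple R n]_(t in [set t | Omega (\row_i tnth t i)])
    (F (\row_i tnth t i) * Num.sqrt (\det (g (\row_i tnth t i))))%:E)%E.

Variable Omega : set E.

Definition sqnormH2 (f : E -> R) : \bar R :=
  riemann_integral Omega (fun x =>
    tensor2 x (hessian f x) (hessian f x)
    + bilin (g x) (gradient f x) (gradient f x) + f x ^+ 2).

Definition preH2 (f : E -> R) : Prop :=
  smooth Omega f /\ (sqnormH2 f < +oo)%E.

(* The completion H^2(Omega), as Cauchy sequences in preH2; two sequences
   represent the same element when their difference tends to 0. *)
Definition cauchyH2 (u : nat -> E -> R) : Prop :=
  (forall k, preH2 (u k)) /\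
  forall e : R, 0 < e -> exists N : nat, forall k l : nat,
    (N <= k)%N -> (N <= l)%N ->
    (sqnormH2 (fun x => (u k x - u l x)%R) < e%:E)%E.

Definition nullH2 (u : nat -> E -> R) : Prop :=
  (fun k => sqnormH2 (u k)) @ \oo --> 0%E.

Definition formL2 (u phi : nat -> E -> R) : R :=
  limn (fun k => fine (riemann_integral Omega (fun x => u k x * phi k x))).

Definition form_biharmonic (u phi : nat -> E -> R) : R :=
  limn (fun k => fine (riemann_integral Omega (fun x =>
    tensor2 x (hessian (u k) x) (hessian (phi k) x)
    + bilin (ricci x) (gradient (u k) x) (gradient (phi k) x)))).

Definition lincomb j (c : 'rV[R]_j) (e : 'I_j -> nat -> E -> R) :
    nat -> E -> R :=
  fun k x => \sum_i c 0 i * e i k x.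

(* e is a basis of a j-dimensional subspace of H^2(Omega) *)
Definition freeH2 j (e : 'I_j -> nat -> E -> R) : Prop :=
  (forall i, cauchyH2 (e i)) /\
  forall c : 'rV[R]_j, nullH2 (lincomb c e) -> c = 0.

Definition rayleigh (u : nat -> E -> R) : R :=
  form_biharmonic u u / formL2 u u.

(* min-max value mu_j; U ranges over the spans of families e as above, and
   min, max are written inf, sup in \bar R so that mu is total. *)
Definition mu (j : nat) : \bar R :=
  ereal_inf [set M | exists2 e : 'I_j -> nat -> E -> R, freeH2 e &
    M = ereal_sup [set (rayleigh (lincomb c e))%:E | c in [set c | c != 0]]].

Definition weak_eigenfunction (lambda : R) (u : nat -> E -> R) : Prop :=
  cauchyH2 u /\ forall phi, cauchyH2 phi ->
    form_biharmonic u phi = lambda * formL2 u phi.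

(* lambda enumerates, in nondecreasing order and repeated with multiplicity,
   the eigenvalues of the weak problem, indexed from 0, and these are the
   min-max values *)
Definition neumann_spectrum (lambda : nat -> R) : Prop :=
  [/\ {homo lambda : i j / (i <= j)%N >-> i <= j},
      forall (r : R) (m : nat),
        (exists2 e : 'I_m -> nat -> E -> R,
           freeH2 e & forall i, weak_eigenfunction r (e i)) <->
        (exists s : 'I_m -> nat, injective s /\ forall i, lambda (s i) = r)
    & forall j, (lambda j)%:E = mu j.+1].

End Riemannian.

(* Upper half-space model of the hyperbolic space of dimension n.+1: the last
   coordinate is the height. *)
Section hyperbolic.
Context {R : realType} {n : nat}.
Local Notation E := 'rV[R]_n.+1.

Definition height (x : E) : R := x 0 ord_max.

Definition halfspace : set E := [set x | 0 < height x].

Definition hyp_metric (x : E) : 'M[R]_n.+1 := (height x ^- 2)%:M.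

(* arcosh (1 + |x - y|^2 / (2 x_n y_n)), |.| being the Euclidean norm (the
   library norm on row vectors is the sup norm) *)
Definition hyp_dist (x y : E) : R :=
  let c := 1 + (\sum_i (x 0 i - y 0 i) ^+ 2) / (2 * height x * height y) in
  ln (c + Num.sqrt (c ^+ 2 - 1)).

Definition hyp_bounded (Omega : set E) : Prop :=
  exists r : R, forall x y, Omega x -> Omega y -> hyp_dist x y <= r.

Definition domain (Omega : set E) : Prop :=
  [/\ Omega `<=` halfspace, open Omega, Omega !=set0 & connected Omega].

(* Near each point of its boundary in the half-space, Omega is one side of the
   graph of a C^1 function over one of the coordinate hyperplanes. *)
Definition C1_boundary (Omega : set E) : Prop :=
  forall p, halfspace p -> closure Omega p -> ~ Omega p ->
    exists (r : R) (i : 'I_n.+1) (b : bool) (gamma : 'rV[R]_n -> R),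
      [/\ 0 < r, classC 1 setT gamma &
          forall x, ball p r x ->
            (Omega x <-> gamma (col' i x) < (-1) ^+ b * x 0 i)].

End hyperbolic.

(* Main.v *)
Require Import Defs.
From HB Require Import structures.
From mathcomp Require Import all_boot all_order all_algebra.
From mathcomp Require Import all_classical all_reals all_analysis.
From mathcomp Require Import ring lra.
Import Order.TTheory GRing.Theory Num.Theory.
Import numFieldNormedType.Exports.
Local Open Scope classical_set_scope.
Local Open Scope ring_scope.
Set Implicit Arguments.
Unset Strict Implicit.
Unset Printing Implicit Defensive.

(** On the hyperbolic space of dimension N the Ricci tensor is - (N - 1) times
    the metric, so the energy density of a function is
    |D^2 f|^2 - (N - 1) |grad f|^2: a function whose gradient is large compared
    with its Hessian has negative energy. By the min-max formula it suffices to
    find N functions, smooth on the whole half-space, on whose span the energy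
    is at most minus a positive multiple of the squared norm of the coefficients
    ([mu_lt0]). Linear independence in H^2 and the positivity of the L^2 norm
    then come for free: a function of zero H^2 norm, or vanishing on Omega, has
    zero energy. A hyperbolically bounded set lies in a box
    m <= y <= M, |x_i| <= L with m > 0 ([Omega_box]), so functions continuous on
    the half-space are bounded on Omega and all the integrals are finite.

    The test functions depend on the dimension. Let x_1, ..., x_(N-1) be the
    horizontal coordinates and y the height.

    For N >= 3 the density is made negative at every point. The functions x_i
    and ln y are mutually orthogonal for the density, which equals (3 - N) y^2
    on x_i and 0 on ln y. They are perturbed to x_i (1 + eps / y) and
    ln y + eps |x|^2, which makes the density negative definite to first order
    in eps, hence everywhere on a bounded Omega for small eps
    ([biharm_trial_fn_le], [mu_lt0_ge3]).

    For N = 2 this breaks down, as 3 - N is positive. Instead let s_t be the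
    signed distance to the geodesic through the point i whose normal has angle
    t. Its Hessian is tanh s_t (g - ds_t^2), and the mixed density of s_t and
    s_t' is negative wherever their gradients make an acute angle
    ([biharm_geodesic_dist_lt0]). On a bounded Omega this holds as soon as t and
    t' are close. Follow the finite chain s_0, s_theta, s_(2 theta), ..., s_pi:
    since s_pi = - s_0, the energy of the pair (s_0, s_(k theta)) goes from
    negative to positive, so for some k there is a combination w of the two
    consecutive functions s_(k theta), s_((k+1) theta), with coefficients of the
    same sign, that is orthogonal to s_0. The terms in the energy of w are
    nonpositive and not all zero, so s_0 and w span a negative plane ([mu_lt0_dim2]).

    The energy of a combination of the first i members of a family is that of a
    combination of the family, so the min-max values increase ([mu_le]). *)

(** * Integration of continuous functions over open sets of coordinates *)

(** The cube is a product of intervals, and [product_tuple] adds one factor at a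
    time. Cubes are the only sets whose exact measure matters: they bound the
    volume of Omega from above and of open sets from below. *)
Lemma lebesgue_tuple_cube (R : realType) (r : R) (hr : 0 <= r) n
    (p : 'I_n -> R) :
  lebesgue_tuple R n [set t | forall i, p i - r < tnth t i < p i + r]
  = ((2 * r) ^+ n)%:E.
Proof.
elim: n p => [|n IH] p.
  rewrite /lebesgue_tuple /= diracE expr0.
  by rewrite mem_set//= => -[].
rewrite /lebesgue_tuple /= /product_cons /pushforward.
rewrite [X in (_ \x _)%E X](_ : _ = `]p ord0 - r, p ord0 + r[%classic `*`
   [set t : n.-tuple (measurableTypeR R) | forall i,
      p (lift ord0 i) - r < tnth t i < p (lift ord0 i) + r]).
  rewrite product_measure1E//.
  - rewrite [X in (_ * X)%E = _](IH (fun i => p (lift ord0 i))).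
    rewrite [X in (X * _)%E](_ : _ =
      lebesgue_measure `]p ord0 - r, p ord0 + r[%classic)//.
    rewrite lebesgue_measure_itv /= lte_fin.
    case: ifPn => h.
      rewrite -EFinB -EFinM exprS; congr (_ * _)%:E.
      ring.
    (* the interval is empty *)
    have -> : r = 0.
      apply/eqP; rewrite eq_le hr andbT leNgt; apply: contra h => r0.
      by rewrite ltrBlDr -addrA ltrDl addr_gt0.
    by rewrite mul0e mulr0 expr0n.
  - rewrite [X in measurable X](_ : _ = \bigcap_(i in [set: 'I_n])
      ((fun t : n.-tuple (measurableTypeR R) => tnth t i) @^-1`
         `]p (lift ord0 i) - r, p (lift ord0 i) + r[%classic)).
      apply: fin_bigcap_measurable => // i _.
      by rewrite -[X in measurable X]setTI; apply: measurable_tnth.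
    apply/seteqP; split => t /= h i; first by move=> _; rewrite /= in_itv/=.
    by have := h i I; rewrite /= in_itv.
apply/seteqP; split => -[x t] /=.
  move=> h; split; first by have := h ord0; rewrite in_itv /= (tnth_nth 0).
  by move=> i; have := h (lift ord0 i); rewrite /cons_pair /= !(tnth_nth 0).
move=> [h0 h] i; case: (unliftP ord0 i) => [j ->|->].
  by have := h j; rewrite /cons_pair /= !(tnth_nth 0).
by move: h0; rewrite in_itv /= (tnth_nth 0).
Qed.

(** The measure lives on tuples, the geometry on row vectors; this transports a
    set from the latter to the former. *)
Definition tuple_pre {R : realType} {n} (A : set 'rV[R]_n) :
  set (n.-tuple (measurableTypeR R)) := [set t | A (\row_i tnth t i)].

Lemma tuple_pre_ballE (R : realType) n (p : 'rV[R]_n) (r : R) (hr : 0 < r) :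
  tuple_pre (ball p r) =
  [set t | forall i, p 0 i - r < tnth t i < p 0 i + r].
Proof.
apply/seteqP; split => t; rewrite /tuple_pre /= /ball /= /mx_ball.
  move=> [_ h] i; have := h ord0 i; rewrite mxE /ball /= ltr_distl.
  by move=> /andP[a b]; apply/andP; split; lra.
move=> h; split => // i j; rewrite ord1 mxE /ball /= ltr_distl.
by have /andP[a b] := h j; apply/andP; split; lra.
Qed.

Lemma lebesgue_tuple_ball (R : realType) n (p : 'rV[R]_n) (r : R) (hr : 0 < r) :
  lebesgue_tuple R n (tuple_pre (ball p r)) = ((2 * r) ^+ n)%:E.
Proof. by rewrite tuple_pre_ballE// lebesgue_tuple_cube// ltW. Qed.

Lemma measurable_tuple_pre_ball (R : realType) n (p : 'rV[R]_n) (r : R)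
  (hr : 0 < r) : measurable (tuple_pre (ball p r)).
Proof.
rewrite tuple_pre_ballE//.
rewrite [X in measurable X](_ : _ = \bigcap_(i in [set: 'I_n])
   ((fun t : n.-tuple (measurableTypeR R) => tnth t i) @^-1`
      `]p 0 i - r, p 0 i + r[%classic)).
  apply: fin_bigcap_measurable => // i _.
  by rewrite -[X in measurable X]setTI; apply: measurable_tnth.
apply/seteqP; split => t /= h i; first by move=> _; rewrite /= in_itv/=.
by have := h i I; rewrite /= in_itv.
Qed.

(** The sigma-algebra is the product one, so an open set is measurable because it
    is a countable union of cubes with rational centre and radius 1/(k+1). *)
Lemma measurable_tuple_pre_open (R : realType) n (A : set 'rV[R]_n) :
  open A -> measurable (tuple_pre A).
Proof.
move=> oA.
pose c (qk : 'rV[rat]_n * nat) : 'rV[R]_n := map_mx ratr qk.1.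
pose F (qk : 'rV[rat]_n * nat) :=
  if `[< ball (c qk) (qk.2.+1%:R^-1) `<=` A >]
  then tuple_pre (ball (c qk) (qk.2.+1%:R^-1)) else set0.
rewrite (_ : tuple_pre A = \bigcup_qk F qk).
  apply: countable_bigcupT_measurable => [|qk]; first exact: countableP.
  rewrite /F; case: ifP => // _; apply: measurable_tuple_pre_ball.
  by rewrite invr_gt0.
apply/seteqP; split => [t At|t [qk _]]; last first.
  by rewrite /F; case: ifPn => // /asboolP h /h.
have /nbhs_ballP[e /= e0 he] : nbhs (\row_i tnth t i) A by exact: open_nbhs_nbhs.
have [k hk] : exists k : nat, k.+1%:R^-1 < e / 2.
  have [|k] := @ltr_add_invr _ 0 (e / 2); first by rewrite divr_gt0.
  by rewrite add0r; exists k.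
have k0 : 0 < k.+1%:R^-1 :> R by rewrite invr_gt0.
have q_ i : {q : rat | `|tnth t i - ratr q| < k.+1%:R^-1}.
  apply: cid.
  have /rat_in_itvoo[q] : tnth t i - k.+1%:R^-1 < tnth t i + k.+1%:R^-1.
    by rewrite ltrBlDr -addrA ltrDl addr_gt0.
  rewrite in_itv /= => /andP[a b]; exists q.
  rewrite ltr_distl; move: (k.+1%:R^-1 : R) a b => d a b.
  by apply/andP; split; lra.
(* the radius is at most e / 2, so this cube lies in the ball of radius e *)
exists (\row_i sval (q_ i), k) => //; rewrite /F ifT; last first.
  apply/asboolP => y [_ hy]; apply: he; split => // i j.
  rewrite ord1; apply: (@ball_splitr _ _ (c (\row_i0 sval (q_ i0), k) 0 j)).
    rewrite /ball /= !mxE; apply: lt_trans hk.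
    by rewrite distrC; apply: (svalP (q_ j)).
  by apply: lt_trans hk; exact: hy.
split => // i j; rewrite ord1 /ball /= !mxE distrC; exact: (svalP (q_ j)).
Qed.

Section tame_integral.
Context {R : realType} {n : nat} (Omega : set 'rV[R]_n).
Hypothesis oOmega : open Omega.
Hypothesis fOmega : (lebesgue_tuple R n (tuple_pre Omega) < +oo)%E.

(** Continuity and boundedness on Omega: the class of integrands for which every
    integral below is finite. *)
Definition tame (F : 'rV[R]_n -> R) :=
  (forall x, Omega x -> {for x, continuous F}) /\
  exists M : R, forall x, Omega x -> `|F x| <= M.

Definition coord_int (F : 'rV[R]_n -> R) : R :=
  \int[lebesgue_tuple R n]_(t in tuple_pre Omega) F (\row_i tnth t i).

Lemma tame_integrable F : tame F ->
  (lebesgue_tuple R n).-integrable (tuple_pre Omega)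
    (EFin \o (fun t => F (\row_i tnth t i))).
Proof.
move=> [cF [M hM]]; apply: measurable_bounded_integrable => //.
- exact: measurable_tuple_pre_open.
- apply: (measurability _ (measurable_realfun.RGenOInfty.measurableE R)).
  move=> /= _ [_ [a ->]] <-.
  rewrite [X in measurable X](_ : _ =
     tuple_pre (Omega `&` F @^-1` `]a, +oo[%classic)).
    apply: measurable_tuple_pre_open.
    rewrite openE => x [Ox Fx]; apply: filterI; first exact: open_nbhs_nbhs.
    by apply: cF => //; apply: open_nbhs_nbhs; split => //; exact: interval_open.
  by apply/seteqP; split.
- exists M; split; first exact: num_real.
  by move=> y My t /= Ot; apply: le_trans (ltW My); exact: hM.
Qed.

Lemma coord_intD F G : tame F -> tame G ->
  coord_int (fun x => F x + G x) = coord_int F + coord_int G.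
Proof.
move=> tF tG; apply: RintegralD; first exact: measurable_tuple_pre_open.
- exact: tame_integrable.
- exact: tame_integrable.
Qed.

Lemma coord_intZ k F : tame F -> coord_int (fun x => k * F x) = k * coord_int F.
Proof.
move=> tF; apply: RintegralZl; first exact: measurable_tuple_pre_open.
exact: tame_integrable.
Qed.

Lemma le_coord_int F G : tame F -> tame G -> (forall x, Omega x -> F x <= G x) ->
  coord_int F <= coord_int G.
Proof.
move=> tF tG FG; apply: le_Rintegral.
- exact: measurable_tuple_pre_open.
- exact: tame_integrable.
- exact: tame_integrable.
- by move=> t Ot; exact: FG.
Qed.

(** By continuity the integrand exceeds half its value at x on a whole cube. *)
Lemma coord_int_gt0 F x : tame F -> (forall y, Omega y -> 0 <= F y) ->
  Omega x -> 0 < F x -> 0 < coord_int F.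
Proof.
move=> tF F0 Ox Fx.
have /nbhs_ballP[r /= r0 hr] :
    nbhs x (Omega `&` F @^-1` `]F x / 2, +oo[%classic).
  apply: filterI; first exact: open_nbhs_nbhs.
  apply: (proj1 tF) => //; apply: open_nbhs_nbhs; split.
    exact: interval_open.
  by rewrite /= in_itv/= andbT ltr_pdivrMr// ltr_pMr// ltr1n.
have mB := measurable_tuple_pre_ball x r0.
have mO := measurable_tuple_pre_open oOmega.
have iF := tame_integrable tF.
have : (((F x / 2) * (2 * r) ^+ n)%:E <= (coord_int F)%:E)%E.
  rewrite /coord_int /Rintegral fineK; last exact: integrable_fin_num.
  rewrite EFinM -(lebesgue_tuple_ball x r0) -integral_cst//.
  apply: (@le_trans _ _ (\int[lebesgue_tuple R n]_(t in tuple_pre (ball x r))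
                     (F (\row_i tnth t i))%:E)%E).
    apply: ge0_le_integral => //.
    - by move=> t _; rewrite lee_fin divr_ge0// ltW.
    - case/integrableP: iF => mF _; apply: measurable_funS mF => //.
      by move=> t Bt; case: (hr _ Bt).
    - move=> t Bt; case: (hr _ Bt) => _ /=.
      by rewrite in_itv/= andbT lee_fin => /ltW.
  apply: ge0_subset_integral => //.
  - by case/integrableP: iF.
  - by move=> t /F0 ?; rewrite lee_fin.
  - by move=> t Bt; case: (hr _ Bt).
rewrite lee_fin; apply: lt_le_trans.
by rewrite mulr_gt0 ?exprn_gt0// ?divr_gt0// mulr_gt0.
Qed.

End tame_integral.

(** * Calculus of smooth functions on an open set *)

Section calculus.
Context {R : realType} {n : nat}.
Local Notation E := 'rV[R]_n.
Implicit Types f g : E -> R.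
Variable U : set E.
Hypothesis oU : open U.

(** The gradient is a parameter, so that partial derivatives are computed by
    assembling a term of this type rather than by rewriting limits. *)
Definition has_partials f (G : 'I_n -> E -> R) :=
  forall x, U x -> forall i, is_derive x (delta_mx 0 i) f (G i x).

Definition cont_on f := forall x, U x -> {for x, continuous f}.

Lemma has_partialsE f G x i : has_partials f G -> U x -> partial i f x = G i x.
Proof. by move=> fG Ux; have [_] := fG x Ux i. Qed.

Lemma near_eq_on f g x : (forall y, U y -> f y = g y) -> U x ->
  \forall y \near x, f y = g y.
Proof. by move=> fg Ux; apply: filterS fg _; exact: open_nbhs_nbhs. Qed.

Lemma partial_ext f g x i : (forall y, U y -> f y = g y) -> U x ->
  partial i f x = partial i g x.
Proof. by move=> fg Ux; apply: near_eq_derive; exact: near_eq_on. Qed.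

Lemma cont_on_ext f g : (forall y, U y -> f y = g y) ->
  cont_on f -> cont_on g.
Proof.
move=> fg cf x Ux; have cfx : f y @[y --> x] --> f x := cf x Ux.
rewrite fg// in cfx; apply: cvg_trans cfx.
apply: (@near_eq_cvg _ _ (nbhs x)); exact: (near_eq_on fg Ux).
Qed.

(** The functions are total but only their values on the open set U matter. This
    lets a partial derivative be replaced by a closed formula valid on U. *)
Lemma classC_ext k f g : (forall y, U y -> f y = g y) ->
  classC k U f -> classC k U g.
Proof.
elim: k f g => [|k IH] f g fg [cf df]; split.
- exact: cont_on_ext cf.
- by [].
- exact: cont_on_ext cf.
- move=> i; have [dfi Ci] := df i; split.
    move=> x Ux; apply: near_eq_derivable (dfi x Ux); exact: near_eq_on.
  by apply: IH Ci => y Uy; exact: partial_ext.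
Qed.

Lemma classC_cont k f : classC k U f -> cont_on f.
Proof. by case: k => [|k] [cf _]. Qed.

Lemma classCW k f : classC k.+1 U f -> classC k U f.
Proof.
elim: k f => [|k IH] f [cf df]; split => // i; have [? ?] := df i.
by split => //; exact: IH.
Qed.

Lemma classCS k f G : cont_on f -> has_partials f G ->
  (forall i, classC k U (G i)) -> classC k.+1 U f.
Proof.
move=> cf fG CG; split => // i; split.
  by move=> x Ux; have [] := fG x Ux i.
by apply: classC_ext (CG i) => y Uy; rewrite (has_partialsE _ fG).
Qed.

Lemma classC_partials k f : classC k.+1 U f ->
  has_partials f (fun i => partial i f).
Proof. by move=> [_ df] x Ux i; apply: derivableP; exact: (df i).1. Qed.

Lemma has_partials_cst c : has_partials (fun=> c) (fun _ _ => 0).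
Proof. by move=> x _ i; apply: is_derive_cst. Qed.

Lemma classC_cst k c : classC k U (fun=> c).
Proof.
elim: k c => [|k IH] c; first by split => // x _; exact: cst_continuous.
apply: (@classCS _ _ (fun _ _ => 0)) => //.
  by move=> x _; exact: cst_continuous.
by move=> x _ i; apply: is_derive_cst.
Qed.

Lemma has_partialsD f g F G : has_partials f F -> has_partials g G ->
  has_partials (fun x => f x + g x) (fun i x => F i x + G i x).
Proof. by move=> fF gG x Ux i; apply: is_deriveD; [exact: fF|exact: gG]. Qed.

Lemma has_partialsM f g F G : has_partials f F -> has_partials g G ->
  has_partials (fun x => f x * g x) (fun i x => f x * G i x + g x * F i x).
Proof. by move=> fF gG x Ux i; apply: is_deriveM; [exact: fF|exact: gG]. Qed.

Lemma has_partialsZ c f F : has_partials f F ->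
  has_partials (fun x => c * f x) (fun i x => c * F i x).
Proof.
move=> fF x Ux i.
have := has_partialsM (has_partials_cst c) fF Ux i.
by rewrite mulr0 addr0.
Qed.

Lemma classCD k f g : classC k U f -> classC k U g ->
  classC k U (fun x => f x + g x).
Proof.
elim: k f g => [|k IH] f g Cf Cg.
  split => // x Ux.
  by apply: continuousD; [exact: (classC_cont Cf)|exact: (classC_cont Cg)].
apply: (@classCS _ _ (fun i x => partial i f x + partial i g x)).
- move=> x Ux.
  by apply: continuousD; [exact: (classC_cont Cf)|exact: (classC_cont Cg)].
- exact: has_partialsD (classC_partials Cf) (classC_partials Cg).
- by move=> i; apply: IH; [exact: (Cf.2 i).2|exact: (Cg.2 i).2].
Qed.

Lemma classCM k f g : classC k U f -> classC k U g ->
  classC k U (fun x => f x * g x).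
Proof.
elim: k f g => [|k IH] f g Cf Cg.
  split => // x Ux.
  by apply: continuousM; [exact: (classC_cont Cf)|exact: (classC_cont Cg)].
apply: (@classCS _ _ (fun i x => f x * partial i g x + g x * partial i f x)).
- move=> x Ux.
  by apply: continuousM; [exact: (classC_cont Cf)|exact: (classC_cont Cg)].
- exact: has_partialsM (classC_partials Cf) (classC_partials Cg).
- move=> i; apply: classCD; apply: IH.
  + exact: classCW.
  + exact: (Cg.2 i).2.
  + exact: classCW.
  + exact: (Cf.2 i).2.
Qed.

Lemma has_partials_coord j :
  has_partials (fun x => x 0 j) (fun i _ => (i == j)%:R).
Proof.
move=> x _ i.
have lim_quot : (fun h : R => h^-1 *: ((h *: (delta_mx 0 i : E) + x) 0 j - x 0 j))
    @ 0^' --> ((i == j)%:R : R).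
  apply: cvg_near_cst; near=> h.
  have h0 : h != 0 by near: h; exact: nbhs_dnbhs_neq.
  rewrite !mxE eqxx /= addrK eq_sym.
  by rewrite [LHS]mulrA mulVf// mul1r.
apply: DeriveDef; first by apply/cvg_ex; exists ((i == j)%:R : R).
exact: cvg_lim lim_quot.
Unshelve. all: by end_near. Qed.

Lemma classC_coord k j : classC k U (fun x => x 0 j).
Proof.
case: k => [|k]; first by split => // x _; exact: coord_continuous.
apply: (@classCS _ _ (fun i _ => (i == j)%:R)).
- by move=> x _; exact: coord_continuous.
- exact: has_partials_coord.
- by move=> i; apply: classC_cst.
Qed.

(** A directional derivative is the derivative of the restriction to a line, which
    reduces the chain rule to the one-variable one. *)
Lemma is_derive_comp1 (phi : R -> R) f x v a d :
  is_derive (f x) 1 phi a -> is_derive x v f d ->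
  is_derive x v (fun y => phi (f y)) (a * d).
Proof.
move=> hphi hf.
have lineE (g : E -> R) : 'D_v g x = 'D_1 (fun h : R => g (h *: v + x)) 0.
  rewrite /derive; set q := (fun h => _); set q' := (fun h => _).
  suff -> : q = q' by [].
  apply/funext => h; rewrite /q /q' /=.
  by rewrite addr0 scale0r add0r [_%:A]mulr1.
have hl : is_derive (0 : R) 1 (fun h : R => f (h *: v + x)) d.
  case: hf => df <-; rewrite lineE.
  exact: derivableP ((derivable1P f x v).1 df).
have hc : is_derive (0 : R) 1 (phi \o (fun h : R => f (h *: v + x))) (a * d).
  by apply: is_derive1_comp => //; rewrite scale0r add0r.
case: hc => dc ec; apply: DeriveDef; first exact: ((derivable1P _ _ _).2 dc).
by rewrite lineE.
Qed.

Lemma has_partials_comp (phi dphi : R -> R) f F :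
  (forall x, U x -> is_derive (f x) 1 phi (dphi (f x))) -> has_partials f F ->
  has_partials (fun x => phi (f x)) (fun i x => dphi (f x) * F i x).
Proof. by move=> h fF x Ux i; apply: is_derive_comp1; [exact: h|exact: fF]. Qed.

Lemma cont_on_comp (phi dphi : R -> R) f :
  (forall x, U x -> is_derive (f x) 1 phi (dphi (f x))) -> cont_on f ->
  cont_on (fun x => phi (f x)).
Proof.
move=> h cf x Ux; apply: continuous_comp; first exact: cf.
apply: differentiable_continuous; apply/derivable1_diffP.
by case: (h x Ux).
Qed.

Lemma smooth_cont f : smooth U f -> cont_on f.
Proof. by move=> /(_ 0%N)/classC_cont. Qed.

Lemma smooth_partials f : smooth U f -> has_partials f (fun i => partial i f).
Proof. by move=> /(_ 1%N)/classC_partials. Qed.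

Lemma smooth_partial f i : smooth U f -> smooth U (partial i f).
Proof. by move=> Cf k; exact: ((Cf k.+1).2 i).2. Qed.

Lemma smoothD f g : smooth U f -> smooth U g -> smooth U (fun x => f x + g x).
Proof. by move=> Cf Cg k; exact: classCD. Qed.

Lemma smoothM f g : smooth U f -> smooth U g -> smooth U (fun x => f x * g x).
Proof. by move=> Cf Cg k; exact: classCM. Qed.

Lemma smooth_cst c : smooth U (fun=> c).
Proof. by move=> k; exact: classC_cst. Qed.

Lemma smooth_coord j : smooth U (fun x => x 0 j).
Proof. by move=> k; exact: classC_coord. Qed.

Lemma smoothN f : smooth U f -> smooth U (fun x => - f x).
Proof.
move=> Cf k; apply: (@classC_ext k (fun x => -1 * f x)).
  by move=> y _; rewrite mulN1r.
by apply: classCM => //; exact: classC_cst.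
Qed.

Lemma smooth_sum m (f : 'I_m -> E -> R) : (forall j, smooth U (f j)) ->
  smooth U (fun x => \sum_j f j x).
Proof.
elim: m f => [|m IH] f Cf k.
  apply: (@classC_ext _ (fun=> 0)); last exact: classC_cst.
  by move=> y _; rewrite big_ord0.
apply: (@classC_ext _ (fun x => f ord0 x + \sum_j f (lift ord0 j) x)).
  by move=> y _; rewrite big_ord_recl.
by apply: classCD; [exact: Cf|exact: IH].
Qed.

(** An equation df = f^p G with G smooth determines the derivatives of f from f
    itself, so f is as smooth as needed once it is continuous. It covers 1/y
    (p = 2) and (1 + X^2)^(-1/2) (p = 3). *)
Lemma smooth_riccati f (p : nat) (G : 'I_n -> E -> R) : cont_on f ->
  (forall i, smooth U (G i)) -> has_partials f (fun i x => f x ^+ p * G i x) ->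
  smooth U f.
Proof.
move=> cf CG fG k; elim: k => [|k IH]; first by split.
apply: (classCS cf fG) => i; apply: classCM; last exact: CG.
elim: p {fG} => [|p IHp].
  apply: (@classC_ext _ (fun=> 1)); last exact: classC_cst.
  by move=> y _; rewrite expr0.
apply: (@classC_ext _ (fun x => f x * f x ^+ p)); last exact: classCM.
by move=> y _; rewrite exprS.
Qed.

Lemma smoothI f G : cont_on f -> has_partials f G ->
  (forall i, smooth U (G i)) -> smooth U f.
Proof.
move=> cf fG CG [|k]; first by split.
by apply: (classCS cf fG) => i; exact: CG.
Qed.

End calculus.

(** * The hyperbolic metric in an orthonormal frame *)

Section kronecker.
Context {R : realType} {m : nat}.
Implicit Types i j : 'I_m.

(** A Kronecker symbol with values in R; being a constant, it is an atom for
    [ring], unlike the coerced boolean. *)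
Definition kron i j : R := (i == j)%:R.

Lemma kronii i : kron i i = 1.
Proof. by rewrite /kron eqxx. Qed.

Lemma kronC i j : kron i j = kron j i.
Proof. by rewrite /kron eq_sym. Qed.

Lemma sum_kron j (F : 'I_m -> R) : \sum_l kron j l * F l = F j.
Proof.
rewrite (bigD1 j)//= kronii mul1r big1 ?addr0// => l /negPf lj.
by rewrite kronC /kron lj mul0r.
Qed.

End kronecker.

Section halfspace_geometry.
Context {R : realType} {n : nat}.
Local Notation E := 'rV[R]_n.+1.
Local Notation H := (@halfspace R n).
Implicit Types f h : E -> R.

Definition inv_height (x : E) : R := (height x)^-1.

(** The covector dy: the Christoffel symbols of the half-space metric are
    polynomials in this and in the Kronecker symbol. *)
Definition vert (i : 'I_n.+1) : R := kron i ord_max.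

Lemma open_halfspace : open H.
Proof.
rewrite (_ : H = (fun x : E => x 0 ord_max) @^-1` `]0, +oo[%classic).
  apply: open_comp; last exact: interval_open.
  by move=> x _; exact: coord_continuous.
by apply/seteqP; split => x; rewrite /halfspace /height /= in_itv/= andbT.
Qed.

Lemma height_neq0 x : H x -> height x != 0.
Proof. by move=> Hx; rewrite gt_eqF. Qed.

Lemma smooth_height : smooth H (@height R n).
Proof. exact: (smooth_coord open_halfspace). Qed.

Lemma has_partials_height : has_partials H (@height R n) (fun i _ => vert i).
Proof. exact: has_partials_coord. Qed.

Lemma is_derive1_inv (t : R) : t != 0 ->
  is_derive t 1 (fun u : R => u^-1) (- t ^- 2).
Proof.
move=> t0; have := @is_deriveV R id t 1 1 t0 (is_derive_id _ _).
by rewrite /GRing.scale /= mulr1.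
Qed.

Lemma has_partials_inv_height :
  has_partials H inv_height (fun i x => inv_height x ^+ 2 * - vert i).
Proof.
move=> x Hx i.
have := is_derive_comp1 (is_derive1_inv (height_neq0 Hx))
  (has_partials_height Hx i).
by rewrite mulNr -mulrN -exprVn.
Qed.

Lemma smooth_inv_height : smooth H inv_height.
Proof.
apply: (smooth_riccati open_halfspace _ _ has_partials_inv_height).
  apply: (cont_on_comp (dphi := fun t => - t ^- 2)).
    by move=> x Hx; apply: is_derive1_inv; exact: height_neq0.
  exact: smooth_cont smooth_height.
by move=> i; exact: (smooth_cst open_halfspace).
Qed.

Lemma has_partials_ln_height :
  has_partials H (fun x => ln (height x)) (fun i x => inv_height x * vert i).
Proof.
move=> x Hx i.
exact: is_derive_comp1 (is_derive1_ln Hx) (has_partials_height Hx i).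
Qed.

Lemma smooth_ln_height : smooth H (fun x => ln (height x)).
Proof.
apply: (smoothI open_halfspace _ has_partials_ln_height).
  exact: (cont_on_comp (fun x Hx => is_derive1_ln Hx)
    (smooth_cont smooth_height)).
move=> i; apply: (smoothM open_halfspace); first exact: smooth_inv_height.
exact: (smooth_cst open_halfspace).
Qed.

Lemma invmx_hyp_metric (x : E) i j :
  invmx (hyp_metric x) i j = kron i j * height x ^+ 2.
Proof. by rewrite /hyp_metric invmx_scalar invrK mxE mulr_natl. Qed.

Lemma partial_hyp_metric (x : E) i j k : H x ->
  partial k (fun y : E => hyp_metric y i j) x
  = kron i j * (-2 * inv_height x ^+ 3 * vert k).
Proof.
move=> Hx.
rewrite (@partial_ext _ _ H open_halfspace _
   (fun y => kron i j * (inv_height y * inv_height y))) //; last first.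
  by move=> y Hy; rewrite /hyp_metric mxE -exprVn -expr2 mulr_natl.
rewrite (has_partialsE k (has_partialsZ _
  (has_partialsM has_partials_inv_height has_partials_inv_height)) Hx).
ring.
Qed.

Lemma christoffelE (x : E) k i j : H x ->
  christoffel hyp_metric k i j x =
  - inv_height x * (vert i * kron j k + vert j * kron i k - vert k * kron i j).
Proof.
move=> Hx; rewrite /christoffel.
pose G l := height x ^+ 2 * (kron j l * (-2 * inv_height x ^+ 3 * vert i)
  + kron i l * (-2 * inv_height x ^+ 3 * vert j)
  - kron i j * (-2 * inv_height x ^+ 3 * vert l)).
rewrite (eq_bigr (fun l => kron k l * G l)); last first.
  by move=> l _; rewrite invmx_hyp_metric !partial_hyp_metric// /G; ring.
rewrite sum_kron /G /inv_height; have := height_neq0 Hx; move: (height x) => y y0.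
by field.
Qed.

Lemma partial_christoffel (x : E) k i j l : H x ->
  partial l (christoffel hyp_metric k i j) x =
  inv_height x ^+ 2 * vert l *
    (vert i * kron j k + vert j * kron i k - vert k * kron i j).
Proof.
move=> Hx; set c := (vert i * _ + _ - _).
rewrite (@partial_ext _ _ H open_halfspace _ (fun y => - c * inv_height y)) //.
  rewrite (has_partialsE l (has_partialsZ _ has_partials_inv_height) Hx).
  ring.
by move=> y Hy; rewrite christoffelE// mulNr mulrC mulNr.
Qed.

Lemma sum_vert : \sum_(i < n.+1) vert i * vert i = 1.
Proof.
by under eq_bigr do rewrite {1}/vert kronC; rewrite sum_kron /vert kronii.
Qed.

(** Index contractions in the curvature and in the Hessian reduce to this form. *)
Lemma sum_contract (A B C : 'I_n.+1 -> R) (D c : R) i j k :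
  \sum_l (kron i l * A l + kron j l * B l + kron k l * C l
          + vert l * vert l * D + c) =
  A i + B j + C k + D + n.+1%:R * c.
Proof.
rewrite !big_split /= !sum_kron -mulr_suml sum_vert mul1r sumr_const card_ord.
by rewrite mulr_natl.
Qed.

(** The metric has constant curvature -1, so in dimension n.+1 the Ricci tensor is
    - n times the metric. *)
Lemma ricciE (x : E) : H x ->
  ricci hyp_metric x = (- n%:R * inv_height x ^+ 2)%:M.
Proof.
move=> Hx; apply/matrixP => j k; rewrite !mxE.
have -> : (- n%:R * inv_height x ^+ 2) *+ (j == k) =
    - n%:R * inv_height x ^+ 2 * kron j k.
  by rewrite -mulr_natr.
pose y2 := inv_height x ^+ 2.
under eq_bigr do rewrite !partial_christoffel//.
rewrite (eq_bigr (fun i => kron j i * (y2 * (vert i * vert k))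
   + kron k i * (y2 * (vert i * vert j)) + kron k i * 0
   + vert i * vert i * (- y2 * kron j k) + - y2 * vert j * vert k)); last first.
  by move=> i _; rewrite kronii [kron k i]kronC /y2; ring.
rewrite sum_contract.
pose S i := y2 * (2 * vert j * vert k - kron j k - vert j * vert k
  + kron j i * kron i k - 2 * kron j i * vert i * vert k
  + vert i * (vert i * kron j k + vert k * kron j i - vert j * kron k i)).
rewrite (eq_bigr (fun i => S i)); last first.
  move=> i _.
  rewrite (eq_bigr (fun p => kron k p * (y2 * vert p * vert j)
    + kron j p * (y2 * (vert p * vert k + vert i *
         (vert i * kron k p + vert k * kron i p - vert p * kron i k)))
    + kron i p * (- y2 * (vert j * vert i * kron k p + vert j * vert k * kron i p
         - vert j * vert p * kron i k)
         - y2 * kron j i * vert p * vert k)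
    + vert p * vert p * (- y2 * kron j k + y2 * kron j i * kron i k)
    + 0 - kron k p * (y2 * vert p * vert i * kron j i))); last first.
    move=> p _; rewrite !christoffelE// kronii [kron p i]kronC /y2; ring.
  rewrite [LHS]big_split /= sum_contract sumrN sum_kron.
  rewrite /S kronii [kron i k]kronC [kron k j]kronC [kron i j]kronC /y2; ring.
rewrite (eq_bigr (fun i => kron j i * (y2 * (kron i k - 2 * vert i * vert k
      + vert i * vert k))
   + kron k i * (- y2 * vert i * vert j) + kron k i * 0
   + vert i * vert i * (y2 * kron j k)
   + y2 * (vert j * vert k - kron j k))); last first.
  by move=> i _; rewrite /S; ring.
rewrite sum_contract -natr1 /y2; ring.
Qed.

(** Components in the orthonormal frame y d/dx_i, in which inner products of
    tensors are sums of products of components. *)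
Definition frame_grad f (x : E) (i : 'I_n.+1) : R := height x * partial i f x.

Definition frame_hess f (x : E) (i j : 'I_n.+1) : R :=
  height x ^+ 2 * partial i (partial j f) x +
  height x * (vert i * partial j f x + vert j * partial i f x
              - kron i j * partial ord_max f x).

(** The integrand <D^2 f, D^2 h> + Ric(grad f, grad h) of the weak problem. *)
Definition biharm f h (x : E) : R :=
  \sum_i \sum_j frame_hess f x i j * frame_hess h x i j
  - n%:R * \sum_i frame_grad f x i * frame_grad h x i.

Lemma hessianE f x i j : H x ->
  hessian hyp_metric f x i j = inv_height x ^+ 2 * frame_hess f x i j.
Proof.
move=> Hx; rewrite /hessian mxE.
rewrite (eq_bigr (fun k => kron j k * (- inv_height x * vert i * partial k f x)
  + kron i k * (- inv_height x * vert j * partial k f x)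
  + kron ord_max k * (inv_height x * kron i j * partial k f x)
  + vert k * vert k * 0 + 0)); last first.
  by move=> k _; rewrite christoffelE// [kron ord_max k]kronC -/(vert k); ring.
rewrite sum_contract /frame_hess /inv_height.
have := height_neq0 Hx; move: (height x) => y y0; by field.
Qed.

Lemma gradientE f x i :
  gradient hyp_metric f x 0 i = height x * frame_grad f x i.
Proof.
rewrite /gradient mxE.
rewrite (eq_bigr (fun j => kron i j * (height x ^+ 2 * partial j f x))).
  by rewrite sum_kron /frame_grad; ring.
by move=> j _; rewrite invmx_hyp_metric; ring.
Qed.

Lemma bilin_scalar (a : R) (v w : E) :
  bilin a%:M v w = a * \sum_i v 0 i * w 0 i.
Proof.
rewrite /bilin mulr_sumr; apply: eq_bigr => i _.
rewrite (eq_bigr (fun j => kron i j * (a * v 0 i * w 0 j))).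
  by rewrite sum_kron mulrA.
by move=> j _; rewrite mxE -mulr_natl /kron; ring.
Qed.

Lemma tensor2_hyp x (A B : 'M[R]_n.+1) :
  tensor2 hyp_metric x A B = \sum_i \sum_j height x ^+ 4 * (A i j * B i j).
Proof.
rewrite /tensor2; apply: eq_bigr => i _; apply: eq_bigr => j _.
rewrite (eq_bigr (fun k => kron i k *
   (height x ^+ 4 * A i j * B k j))) ?sum_kron ?mulrA// => k _.
rewrite (eq_bigr (fun l => kron j l *
   (kron i k * (height x ^+ 4 * A i j * B k l)))) ?sum_kron// => l _.
by rewrite !invmx_hyp_metric; ring.
Qed.

Lemma tensor2_hessian f h x : H x ->
  tensor2 hyp_metric x (hessian hyp_metric f x) (hessian hyp_metric h x) =
  \sum_i \sum_j frame_hess f x i j * frame_hess h x i j.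
Proof.
move=> Hx; rewrite tensor2_hyp; apply: eq_bigr => i _; apply: eq_bigr => j _.
rewrite !hessianE// /inv_height.
have := height_neq0 Hx; move: (height x) => y y0; by field.
Qed.

Lemma bilin_gradient (a : R) f h x : H x ->
  bilin (a * inv_height x ^+ 2)%:M (gradient hyp_metric f x) (gradient hyp_metric h x)
  = a * \sum_i frame_grad f x i * frame_grad h x i.
Proof.
move=> Hx; rewrite bilin_scalar -mulrA mulr_sumr; congr (_ * _).
apply: eq_bigr => i _; rewrite !gradientE /inv_height.
have := height_neq0 Hx; move: (height x) => y y0; by field.
Qed.

Lemma biharmE f h x : H x ->
  tensor2 hyp_metric x (hessian hyp_metric f x) (hessian hyp_metric h x)
  + bilin (ricci hyp_metric x) (gradient hyp_metric f x)
      (gradient hyp_metric h x) = biharm f h x.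
Proof.
by move=> Hx; rewrite tensor2_hessian// ricciE// bilin_gradient// mulNr.
Qed.

(** The integrand of the squared H^2 norm. *)
Definition sobolev f (x : E) : R :=
  \sum_i \sum_j frame_hess f x i j * frame_hess f x i j
  + \sum_i frame_grad f x i * frame_grad f x i + f x ^+ 2.

Lemma sobolevE f x : H x ->
  tensor2 hyp_metric x (hessian hyp_metric f x) (hessian hyp_metric f x)
    + bilin (hyp_metric x) (gradient hyp_metric f x) (gradient hyp_metric f x)
    + f x ^+ 2 = sobolev f x.
Proof.
move=> Hx; rewrite tensor2_hessian// /hyp_metric.
have -> : height x ^- 2 = 1 * inv_height x ^+ 2 by rewrite mul1r -exprVn.
by rewrite bilin_gradient// mul1r.
Qed.

(** In dimension n.+1 the determinant of the metric is y^(-2(n.+1)). *)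
Lemma volume_density x : H x ->
  Num.sqrt (\det (hyp_metric x)) = inv_height x ^+ n.+1.
Proof.
move=> Hx; rewrite /hyp_metric det_scalar -exprVn -exprM mulnC exprM sqrtr_sqr.
by rewrite ger0_norm// exprn_ge0// invr_ge0 ltW.
Qed.

Lemma smooth_frame_grad f i : smooth H f -> smooth H (fun x => frame_grad f x i).
Proof.
move=> Cf; apply: (smoothM open_halfspace smooth_height).
exact: (smooth_partial i Cf).
Qed.

Lemma smooth_frame_hess f i j : smooth H f -> smooth H (fun x => frame_hess f x i j).
Proof.
move=> Cf; have oH := open_halfspace; have Cy := smooth_height.
have Cp k := smooth_partial k Cf.
apply: (smoothD oH).
  by apply: (smoothM oH) (smooth_partial i (Cp j)); exact: (smoothM oH Cy Cy).
apply: (smoothM oH Cy); apply: (smoothD oH).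
  by apply: (smoothD oH); apply: (smoothM oH (smooth_cst oH _)).
by apply: (smoothN oH); apply: (smoothM oH (smooth_cst oH _)).
Qed.

Lemma smooth_biharm f h : smooth H f -> smooth H h -> smooth H (biharm f h).
Proof.
move=> Cf Ch; have oH := open_halfspace.
apply: (smoothD oH).
  apply: (smooth_sum oH) => i; apply: (smooth_sum oH) => j.
  by apply: (smoothM oH); exact: smooth_frame_hess.
apply: (smoothN oH); apply: (smoothM oH (smooth_cst oH _)).
apply: (smooth_sum oH) => i.
by apply: (smoothM oH); exact: smooth_frame_grad.
Qed.

Lemma smooth_sobolev f : smooth H f -> smooth H (sobolev f).
Proof.
move=> Cf; have oH := open_halfspace.
apply: (smoothD oH); last exact: (smoothM oH Cf Cf).
apply: (smoothD oH).
  apply: (smooth_sum oH) => i; apply: (smooth_sum oH) => j.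
  by apply: (smoothM oH); exact: smooth_frame_hess.
apply: (smooth_sum oH) => i.
by apply: (smoothM oH); exact: smooth_frame_grad.
Qed.

Lemma has_partials_lincomb m (c : 'I_m -> R) (e : 'I_m -> E -> R) F :
  (forall j, has_partials H (e j) (F j)) ->
  has_partials H (fun x => \sum_j c j * e j x)
    (fun i x => \sum_j c j * F j i x).
Proof.
move=> eF x Hx i.
have -> : (fun x => \sum_j c j * e j x) = \sum_j (fun x => c j * e j x).
  by apply/funext => y; rewrite fct_sumE.
by apply: is_derive_sum => j; exact: (has_partialsZ (c j) (eF j) Hx i).
Qed.

Lemma frame_grad_lincomb m (c : 'I_m -> R) (e : 'I_m -> E -> R) x i :
  (forall j, smooth H (e j)) -> H x ->
  frame_grad (fun x => \sum_j c j * e j x) x i = \sum_j c j * frame_grad (e j) x i.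
Proof.
move=> Ce Hx; rewrite /frame_grad.
rewrite (has_partialsE i (has_partials_lincomb c
          (fun j => smooth_partials (Ce j))) Hx) mulr_sumr.
by apply: eq_bigr => j _; ring.
Qed.

Lemma frame_hess_lincomb m (c : 'I_m -> R) (e : 'I_m -> E -> R) x i j :
  (forall j, smooth H (e j)) -> H x ->
  frame_hess (fun x => \sum_j c j * e j x) x i j = \sum_l c l * frame_hess (e l) x i j.
Proof.
move=> Ce Hx; rewrite /frame_hess.
have P1 y k : H y -> partial k (fun x => \sum_j c j * e j x) y =
    \sum_j c j * partial k (e j) y.
  by move=> Hy; rewrite (has_partialsE k (has_partials_lincomb c
          (fun j => smooth_partials (Ce j))) Hy).
rewrite (partial_ext open_halfspace i (fun y Hy => P1 y j Hy) Hx) !P1//.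
rewrite (has_partialsE i (has_partials_lincomb c
  (fun l => smooth_partials (smooth_partial j (Ce l)))) Hx).
rewrite !mulr_sumr -!big_split -sumrN -big_split /= mulr_sumr -big_split /=.
by apply: eq_bigr => l _; ring.
Qed.

Lemma biharm_lincomb m (c : 'I_m -> R) (e : 'I_m -> E -> R) h x :
  (forall j, smooth H (e j)) -> H x ->
  biharm (fun x => \sum_j c j * e j x) h x = \sum_l c l * biharm (e l) h x.
Proof.
move=> Ce Hx; rewrite /biharm.
under [RHS]eq_bigr do rewrite mulrBr.
rewrite big_split sumrN /=; congr (_ - _).
  under [RHS]eq_bigr do rewrite mulr_sumr; rewrite [RHS]exchange_big /=.
  apply: eq_bigr => i _.
  under [RHS]eq_bigr do rewrite mulr_sumr; rewrite [RHS]exchange_big /=.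
  apply: eq_bigr => j _; rewrite frame_hess_lincomb// mulr_suml.
  by apply: eq_bigr => l _; rewrite mulrA.
under [RHS]eq_bigr do rewrite mulrCA mulr_sumr.
rewrite -mulr_sumr [in RHS]exchange_big /=; congr (_ * _).
apply: eq_bigr => i _; rewrite frame_grad_lincomb// mulr_suml.
by apply: eq_bigr => l _; rewrite [RHS]mulrA.
Qed.

Lemma biharmC f h x : biharm f h x = biharm h f x.
Proof.
rewrite /biharm; congr (_ - _ * _); last by apply: eq_bigr => i _; rewrite mulrC.
by apply: eq_bigr => i _; apply: eq_bigr => j _; rewrite mulrC.
Qed.

End halfspace_geometry.

(** * Bounded domains and the negativity criterion *)

(** Lagrange's identity: the difference of the two sides is half the sum of the
    squares of the 2 by 2 minors. *)
Lemma cauchy_schwarz_sum (R : realDomainType) m (a b : 'I_m -> R) :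
  (\sum_i a i * b i) ^+ 2 <= (\sum_i a i ^+ 2) * \sum_i b i * b i.
Proof.
have : 0 <= \sum_i \sum_j (a i * b j - a j * b i) ^+ 2.
  by do 2 apply: sumr_ge0 => ? _; exact: sqr_ge0.
suff -> : \sum_i \sum_j (a i * b j - a j * b i) ^+ 2 =
  2 * ((\sum_i a i ^+ 2) * (\sum_i b i * b i) - (\sum_i a i * b i) ^+ 2).
  by rewrite pmulr_rge0// subr_ge0.
rewrite expr2 !big_distrlr /= -sumrB.
under [in RHS]eq_bigr do rewrite -sumrB.
(* each square of a minor is F i j + F j i *)
pose F i j := a i ^+ 2 * (b j * b j) - a i * b i * (a j * b j).
transitivity (\sum_i \sum_j F i j + \sum_i \sum_j F j i).
  rewrite -big_split; apply: eq_bigr => i _.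
  by rewrite -big_split; apply: eq_bigr => j _; rewrite /F /=; ring.
by rewrite [X in _ + X]exchange_big /= -mulr2n -[LHS]mulr_natl.
Qed.

Section min_max.
Context {R : realType} {n : nat} (g : 'rV[R]_n -> 'M[R]_n) (Omega : set 'rV[R]_n).

(** The first i members of a family span a subspace of its span: their
    combinations are those with zero coefficients on the other members. *)
Lemma lincomb_lshift i d (c : 'rV[R]_i)
    (e : 'I_(i + d) -> nat -> 'rV[R]_n -> R) :
  lincomb (row_mx c (0 : 'rV[R]_d)) e = lincomb c (fun k => e (lshift d k)).
Proof.
apply/funext => k; apply/funext => x; rewrite /lincomb big_split_ord /=.
rewrite [X in _ + X]big1 ?addr0; last by move=> l _; rewrite row_mxEr mxE mul0r.
by apply: eq_bigr => l _; rewrite row_mxEl.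
Qed.

(** Dropping members of a free family leaves a free family with no larger
    supremum of Rayleigh quotients. *)
Lemma mu_le i j : (i <= j)%N -> (mu g Omega i <= mu g Omega j)%E.
Proof.
move=> ij; rewrite -(subnKC ij); move: (j - i)%N => d {ij j}.
apply: le_ereal_inf_tmp => _ [e [ce fe] ->].
apply: (@le_trans _ _ (ereal_sup
   [set (rayleigh g Omega (lincomb c (fun k => e (lshift d k))))%:E
     | c in [set c | c != 0]])).
  apply: ereal_inf_lbound; exists (fun k => e (lshift d k)) => //.
  split=> [k|c]; first exact: ce.
  rewrite -lincomb_lshift => /fe/eqP; rewrite row_mx_eq0 => /andP[/eqP].
  by [].
apply: ge_ereal_sup => _ [c /= c0 <-]; apply: ereal_sup_ubound.
exists (row_mx c 0); last by rewrite lincomb_lshift.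
by rewrite /= row_mx_eq0 negb_and c0.
Qed.
End min_max.

Section bounded_domain.
Context {R : realType} {n : nat} (Omega : set 'rV[R]_n.+1).
Local Notation E := 'rV[R]_n.+1.
Local Notation H := (@halfspace R n).
Hypothesis OmegaH : Omega `<=` H.
Hypothesis oOmega : open Omega.
Hypothesis bOmega : hyp_bounded Omega.

(** The logarithm in [hyp_dist] is the inverse of cosh on values c >= 1, and
    c <= c + sqrt (c^2 - 1) <= exp r. *)
Lemma hyp_dist_cosh (x y : E) r : H x -> H y -> hyp_dist x y <= r ->
  \sum_i (x 0 i - y 0 i) ^+ 2 <= expR r * (2 * height x * height y).
Proof.
move=> Hx Hy; rewrite /hyp_dist.
set S := \sum_i _; set D := 2 * _ * _; set c := 1 + S / D => h.
have D0 : 0 < D by rewrite !mulr_gt0.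
have S0 : 0 <= S by apply: sumr_ge0 => i _; exact: sqr_ge0.
have c1 : 1 <= c by rewrite lerDl divr_ge0// ltW.
have c0 : 0 < c + Num.sqrt (c ^+ 2 - 1).
  by rewrite ltr_wpDr ?sqrtr_ge0// (lt_le_trans ltr01).
have : c <= expR r.
  apply: (@le_trans _ _ (c + Num.sqrt (c ^+ 2 - 1))).
    by rewrite lerDl sqrtr_ge0.
  by rewrite -(lnK c0) ler_expR.
rewrite -ler_pdivrMr//; apply: le_trans.
by rewrite /c lerDr.
Qed.

(** With p a point of Omega of height b, the distance bound reads
    |x - p|^2 <= 2 K b y. Its vertical part y^2 + b^2 <= 2 (1 + K) b y bounds y
    above and away from 0, and then the whole bounds the coordinates of x. *)
Lemma Omega_box : Omega !=set0 -> exists m M L : R, 0 < m /\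
  forall x, Omega x -> [/\ m <= height x, height x <= M
    & forall i, `|x 0 i| <= L].
Proof.
move=> [p Op]; have [r hr] := bOmega.
have Hp : 0 < height p := OmegaH Op.
set b := height p in Hp.
have K0 : 0 < expR r by exact: expR_gt0.
set K := expR r in K0.
(* y ^+ 2 + b ^+ 2 <= M * y for the height y of any point of Omega *)
pose M := 2 * b + 2 * K * b.
have M0 : 0 < M by rewrite /M addr_gt0// !mulr_gt0.
exists (b ^+ 2 / M), M, (\sum_i `|p 0 i| + (2 * K * M * b + 1)).
split; first by rewrite divr_gt0// exprn_gt0.
move=> x Ox; have Hx : 0 < height x := OmegaH Ox.
have hS := hyp_dist_cosh (OmegaH Ox) (OmegaH Op) (hr _ _ Ox Op).
have term i : (x 0 i - p 0 i) ^+ 2 <= K * (2 * height x * b).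
  apply: le_trans hS; rewrite (bigD1 i)//= lerDl.
  by apply: sumr_ge0 => j _; exact: sqr_ge0.
have := term ord_max; rewrite -/(height x) -/(height p) -/b => ty.
have key : height x ^+ 2 + b ^+ 2 <= M * height x.
  by move: ty; rewrite /M; move: (height x) => y; nra.
have yM : height x <= M.
  rewrite -(ler_pM2r Hx) -expr2; apply: le_trans key.
  by rewrite lerDl sqr_ge0.
split => //.
  rewrite ler_pdivrMr// mulrC; apply: le_trans key.
  by rewrite lerDr sqr_ge0.
move=> i; have ti := term i.
have : `|x 0 i - p 0 i| <= 2 * K * M * b + 1.
  have : `|x 0 i - p 0 i| ^+ 2 <= 2 * K * M * b.
    rewrite real_normK ?num_real//; apply: le_trans ti _.
    rewrite [leLHS](_ : _ = (2 * K * b) * height x); last by ring.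
    rewrite [leRHS](_ : _ = (2 * K * b) * M); last by ring.
    by rewrite ler_pM2l// !mulr_gt0.
  move: (`|_|) (normr_ge0 (x 0 i - p 0 i)) (2 * K * M * b) => t t0 Q tQ.
  (* t ^+ 2 <= Q gives t <= Q + 1 *)
  have : 0 <= (t - 1) ^+ 2 by exact: sqr_ge0.
  rewrite sqrrB1; nra.
move=> ht; rewrite -[x 0 i](subrK (p 0 i)); apply: le_trans (ler_normD _ _) _.
rewrite addrC lerD// (bigD1 i)//= lerDl; exact: sumr_ge0.
Qed.

Hypothesis Omega0 : Omega !=set0.

(** Omega is contained in a compact box of the half-space. *)
Lemma Omega_tame f : cont_on H f -> tame Omega f.
Proof.
move=> cf; split; first by move=> x /OmegaH; exact: cf.
have [m [M [L [m0 hO]]]] := Omega_box Omega0.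
pose A (i : 'I_n.+1) : set R :=
  if i == ord_max then `[m, M]%classic else `[- L, L]%classic.
pose K : set E := [set v | forall i, A i (v 0 i)].
have cK : compact K.
  by apply: rV_compact => i; rewrite /A; case: ifP => _; exact: segment_compact.
have KH : K `<=` H.
  move=> x /(_ ord_max); rewrite /A eqxx /= in_itv /= => /andP[mx _].
  exact: lt_le_trans m0 mx.
have /compact_bounded[B [_ hB]] : compact (f @` K).
  apply: continuous_compact => //; apply: continuous_in_subspaceT => x.
  by rewrite inE => /KH; exact: cf.
exists (B + 1) => x Ox; apply: (hB (B + 1)); first by rewrite ltrDl.
exists x => //= i; have [? ? h] := hO _ Ox.
rewrite /A; case: ifPn => [/eqP ->|_]; rewrite /= in_itv /=.
  by apply/andP.
by rewrite -ler_norml.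
Qed.

Lemma smooth_tame f : smooth H f -> tame Omega f.
Proof. by move=> Cf; apply: Omega_tame; exact: smooth_cont Cf. Qed.

Lemma Omega_finite : (lebesgue_tuple R n.+1 (tuple_pre Omega) < +oo)%E.
Proof.
have [m [M [L [m0 hO]]]] := Omega_box Omega0.
pose r := `|L| + 1; have r0 : 0 < r by rewrite ltr_wpDl.
apply: (@le_lt_trans _ _ (lebesgue_tuple R n.+1 (tuple_pre (ball (0 : E) r)))).
  apply: le_measure; rewrite ?inE.
  - exact: measurable_tuple_pre_open.
  - exact: measurable_tuple_pre_ball.
  - move=> t Ot; split => // i j; rewrite ord1 /ball /= !mxE sub0r normrN.
    have [_ _ /(_ j)] := hO _ Ot; rewrite mxE => h; apply: (le_lt_trans h).
    by rewrite (le_lt_trans (ler_norm _))// ltrDl.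
by rewrite lebesgue_tuple_ball// ltry.
Qed.

(** Integral over Omega against the hyperbolic volume. *)
Definition hyp_int (F : E -> R) : R :=
  coord_int Omega (fun x => F x * inv_height x ^+ n.+1).

Let oH := @open_halfspace R n.

Lemma smooth_inv_heightX k : smooth H (fun x => inv_height x ^+ k).
Proof.
elim: k => [|k IH] l.
  apply: (classC_ext oH (f := fun=> 1)); last exact: (classC_cst oH).
  by move=> y _; rewrite expr0.
apply: (classC_ext oH (f := fun x => inv_height x * inv_height x ^+ k)).
  by move=> y _; rewrite exprS.
by apply: (classCM oH); [exact: smooth_inv_height|exact: IH].
Qed.

Lemma density_gt0 x : H x -> 0 < inv_height x ^+ n.+1.
Proof. by move=> Hx; rewrite exprn_gt0// invr_gt0. Qed.

Lemma smooth_density_tame F : smooth H F ->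
  tame Omega (fun x => F x * inv_height x ^+ n.+1).
Proof.
move=> CF; apply: smooth_tame; apply: (smoothM oH) => //.
exact: smooth_inv_heightX.
Qed.

Lemma hyp_intD F G : smooth H F -> smooth H G ->
  hyp_int (fun x => F x + G x) = hyp_int F + hyp_int G.
Proof.
move=> CF CG; rewrite /hyp_int -(coord_intD oOmega Omega_finite).
- by congr coord_int; apply/funext => x; rewrite mulrDl.
- exact: smooth_density_tame.
- exact: smooth_density_tame.
Qed.

Lemma hyp_intZ k F : smooth H F -> hyp_int (fun x => k * F x) = k * hyp_int F.
Proof.
move=> CF; rewrite /hyp_int -(coord_intZ oOmega Omega_finite).
- by congr coord_int; apply/funext => x; rewrite mulrA.
- exact: smooth_density_tame.
Qed.

Lemma hyp_int_ext F G : (forall x, Omega x -> F x = G x) -> hyp_int F = hyp_int G.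
Proof.
move=> FG; apply: eq_Rintegral => t; rewrite inE => Ot.
by rewrite FG.
Qed.

Lemma le_hyp_int F G : smooth H F -> smooth H G ->
  (forall x, Omega x -> F x <= G x) -> hyp_int F <= hyp_int G.
Proof.
move=> CF CG FG; apply: (le_coord_int oOmega Omega_finite).
- exact: smooth_density_tame.
- exact: smooth_density_tame.
- by move=> x Ox; rewrite ler_pM2r ?FG// density_gt0//; exact: OmegaH.
Qed.

Lemma hyp_int_gt0 F x : smooth H F -> (forall y, Omega y -> 0 <= F y) ->
  Omega x -> 0 < F x -> 0 < hyp_int F.
Proof.
move=> CF F0 Ox Fx; apply: (coord_int_gt0 oOmega Omega_finite (x := x)) => //.
- exact: smooth_density_tame.
- by move=> y Oy; rewrite mulr_ge0 ?F0// ltW// density_gt0//; exact: OmegaH.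
- by rewrite mulr_gt0// density_gt0//; exact: OmegaH.
Qed.

Lemma hyp_int_sum m (F : 'I_m -> E -> R) : (forall j, smooth H (F j)) ->
  hyp_int (fun x => \sum_j F j x) = \sum_j hyp_int (F j).
Proof.
elim: m F => [|m IH] F CF.
  rewrite big_ord0 -[RHS](mul0r (hyp_int (fun=> 0))) -hyp_intZ.
    by apply: hyp_int_ext => x _; rewrite big_ord0 mulr0.
  exact: (smooth_cst oH).
rewrite big_ord_recl -IH// -hyp_intD//.
  by apply: hyp_int_ext => x _; rewrite big_ord_recl.
exact: (smooth_sum oH).
Qed.

Lemma riemann_integralE F G : smooth H G -> (forall x, H x -> F x = G x) ->
  riemann_integral hyp_metric Omega F = (hyp_int G)%:E.
Proof.
move=> CG FG; rewrite /hyp_int /coord_int /Rintegral fineK.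
  apply: eq_integral => t; rewrite inE => Ot; have Ht := OmegaH Ot.
  by rewrite FG// volume_density.
apply: integrable_fin_num; first exact: measurable_tuple_pre_open.
exact: (tame_integrable oOmega Omega_finite (smooth_density_tame CG)).
Qed.

Lemma sqnormH2E f : smooth H f ->
  sqnormH2 hyp_metric Omega f = (hyp_int (sobolev f))%:E.
Proof.
move=> Cf; apply: riemann_integralE; first exact: smooth_sobolev.
by move=> x Hx; exact: sobolevE.
Qed.

Lemma smooth_sub (A B : set E) f : A `<=` B -> smooth B f -> smooth A f.
Proof.
move=> AB Cf k; have {Cf} := Cf k.
elim: k f => [|k IH] f [cf df]; split => //; do ?by move=> x /AB; exact: cf.
by move=> i; have [dfi Ci] := df i; split; [move=> x /AB; exact: dfi|exact: IH].
Qed.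

Lemma sobolev0 x : H x -> sobolev (fun=> 0 : R) x = 0.
Proof.
move=> Hx; have P0 y i : H y -> partial i (fun=> 0 : R) y = 0.
  by move=> Hy; rewrite (has_partialsE i (@has_partials_cst _ _ H 0) Hy).
have PP i j : partial i (partial j (fun=> 0 : R)) x = 0.
  by rewrite (partial_ext oH i (fun y Hy => P0 y j Hy) Hx) P0.
rewrite /sobolev expr0n addr0 !big1 ?addr0// => i _.
  by rewrite /frame_grad !P0// mulr0 mul0r.
by rewrite big1// => j _; rewrite /frame_hess PP !P0//; ring.
Qed.

Lemma cauchyH2_cst f : smooth H f ->
  cauchyH2 hyp_metric Omega (fun=> f).
Proof.
move=> Cf; split=> [_|e e0].
  split; first exact: smooth_sub Cf.
  by rewrite sqnormH2E// ltry.
exists 0%N => _ _ _ _.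
have C0 : smooth H (fun=> 0 : R) by exact: (smooth_cst oH).
rewrite (_ : (fun x => f x - f x) = fun=> 0); last first.
  by apply/funext => x; rewrite subrr.
rewrite sqnormH2E// (@hyp_int_ext _ (fun x => 0 * 0)).
  by rewrite hyp_intZ// mul0r lte_fin.
by move=> x Ox; rewrite sobolev0 ?mul0r//; exact: OmegaH.
Qed.

(** Only the gradient contributes negatively to the energy density, so negative
    energy forces a positive H^2 norm. *)
Lemma biharm_lb (f : E -> R) x : - biharm f f x <= n%:R * sobolev f x.
Proof.
rewrite /biharm /sobolev opprB.
have S0 : 0 <= \sum_i \sum_j frame_hess f x i j * frame_hess f x i j.
  by do 2 apply: sumr_ge0 => ? _; rewrite -expr2 sqr_ge0.
move: S0 (sqr_ge0 (f x)) (ler0n R n) => S0 f0 n0; set G := \sum_i _ * _.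
rewrite mulrDr mulrDr.
apply: (@le_trans _ _ (n%:R * G)); first by rewrite gerBl.
rewrite addrAC lerDr addr_ge0// mulr_ge0//.
Qed.

(** Negativity of the energy on the span gives everything the min-max formula
    asks for. The family is free, because by [biharm_lb] a nonzero combination
    has positive H^2 norm. Its L^2 norm is positive, because a continuous
    function with zero L^2 norm vanishes on Omega together with its derivatives
    and would have zero energy. The L^2 norm is also at most a multiple K of the
    norm of the coefficients, so the Rayleigh quotients are at most
    - kappa / K. *)
Lemma mu_lt0 j (e : 'I_j -> E -> R) (kappa : R) : (forall i, smooth H (e i)) ->
  0 < kappa ->
  (forall c : 'rV_j,
     let u := fun x => \sum_i c 0 i * e i x in
     hyp_int (biharm u u) <= - kappa * \sum_i c 0 i ^+ 2) ->
  (mu hyp_metric Omega j < 0)%E.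
Proof.
move=> Ce k0 neg.
pose u (c : 'rV_j) := fun x => \sum_i c 0 i * e i x.
have Cu c : smooth H (u c).
  apply: (smooth_sum oH) => i; apply: (smoothM oH) => //.
  exact: (smooth_cst oH).
have normc c : c != 0 -> 0 < \sum_i (c : 'rV[R]_j) 0 i ^+ 2.
  move=> /eqP c0; rewrite lt_neqAle sumr_ge0 ?andbT; last by move=> *; exact: sqr_ge0.
  apply/negP => /eqP/esym/eqP; rewrite psumr_eq0; last by move=> *; exact: sqr_ge0.
  move=> /allP h; apply: c0; apply/rowP => i; rewrite mxE.
  by apply/eqP; have := h i (mem_index_enum _); rewrite /= sqrf_eq0.
have Bneg c : c != 0 -> hyp_int (biharm (u c) (u c)) < 0.
  move=> c0; apply: le_lt_trans (neg c) _.
  by rewrite mulNr oppr_lt0 mulr_gt0// normc.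
have L2pos c : c != 0 -> 0 < hyp_int (fun x => u c x * u c x).
  move=> c0; have [[x Ox ux]|h] := pselect (exists2 x, Omega x & u c x != 0).
    apply: (hyp_int_gt0 (x := x)) => //; first exact: (smoothM oH).
      by move=> y _; rewrite -expr2 sqr_ge0.
    by rewrite -expr2 exprn_even_gt0.
  (* otherwise u c and all its derivatives vanish on Omega *)
  have u0 y : Omega y -> u c y = 0.
    by move=> Oy; apply/eqP/negPn/negP => uy; apply: h; exists y.
  have := Bneg c c0; rewrite (@hyp_int_ext _ (fun x => 0 * 0)).
    rewrite hyp_intZ ?mul0r ?ltxx//; exact: (smooth_cst oH).
  move=> x Ox; rewrite mul0r.
  have P0 y i : Omega y -> partial i (u c) y = 0.
    move=> Oy; rewrite (partial_ext oOmega i u0 Oy).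
    exact: (has_partialsE i (@has_partials_cst _ _ Omega 0) Oy).
  have PP i l : partial i (partial l (u c)) x = 0.
    rewrite (partial_ext oOmega i (fun y Oy => P0 y l Oy) Ox).
    exact: (has_partialsE i (@has_partials_cst _ _ Omega 0) Ox).
  rewrite /biharm !big1 ?mulr0 ?subr0// => i _.
    by rewrite /frame_grad P0// mulr0 mul0r.
  by rewrite big1// => l _; rewrite /frame_hess PP !P0//; ring.
have [K [K0 hK]] : exists K, 0 < K /\
    forall c, hyp_int (fun x => u c x * u c x) <= K * \sum_i c 0 i ^+ 2.
  pose S x := \sum_i e i x * e i x.
  have CS : smooth H S.
    by apply: (smooth_sum oH) => i; exact: (smoothM oH).
  exists (`|hyp_int S| + 1); split; first by rewrite ltr_wpDl.
  move=> c; set N := \sum_i _.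
  have N0 : 0 <= N by apply: sumr_ge0 => i _; exact: sqr_ge0.
  apply: (@le_trans _ _ (hyp_int (fun x => N * S x))).
    apply: le_hyp_int; first exact: (smoothM oH).
      by apply: (smoothM oH) => //; exact: (smooth_cst oH).
    move=> x Ox; rewrite -expr2 /N /S.
    exact: cauchy_schwarz_sum.
  rewrite hyp_intZ// mulrC ler_wpM2r//.
  by rewrite (le_trans (ler_norm _))// lerDl.
have lincombE c : lincomb c (fun i (_ : nat) => e i) = fun=> u c by [].
apply: (@le_lt_trans _ _ (- kappa / K)%:E); last first.
  by rewrite lte_fin mulNr oppr_lt0 divr_gt0.
apply: ge_ereal_inf.
exists (ereal_sup [set (rayleigh hyp_metric Omega
    (lincomb c (fun i _ => e i)))%:E | c in [set c | c != 0]]).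
  exists (fun i _ => e i) => //; split; first by move=> i; exact: cauchyH2_cst.
  move=> c; rewrite lincombE /nullH2 => h0; apply/eqP/negPn/negP => c0.
  have e0 : (hyp_int (sobolev (u c)))%:E = 0%E.
    rewrite -sqnormH2E//; apply: (cvg_unique _ _ h0) => //; exact: cvg_cst.
  have := Bneg c c0; rewrite ltNge => /negP; apply.
  rewrite -oppr_le0.
  have -> : - hyp_int (biharm (u c) (u c)) =
      hyp_int (fun x => -1 * biharm (u c) (u c) x).
    by rewrite hyp_intZ ?mulN1r//; exact: smooth_biharm.
  apply: (@le_trans _ _ (hyp_int (fun x => n%:R * sobolev (u c) x))).
    apply: le_hyp_int.
    - apply: (smoothM oH); [exact: (smooth_cst oH)|exact: smooth_biharm].
    - apply: (smoothM oH); [exact: (smooth_cst oH)|exact: smooth_sobolev].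
    - by move=> x _; rewrite mulN1r; exact: biharm_lb.
  rewrite hyp_intZ; last exact: smooth_sobolev.
  by case: e0 => ->; rewrite mulr0.
apply: ge_ereal_sup => _ [c /= c0 <-]; rewrite lincombE lee_fin /rayleigh.
have -> : formL2 hyp_metric Omega (fun=> u c) (fun=> u c)
    = hyp_int (fun x => u c x * u c x).
  rewrite /formL2 lim_cst// (@riemann_integralE _ (fun x => u c x * u c x))//.
  exact: (smoothM oH).
have -> : form_biharmonic hyp_metric Omega (fun=> u c) (fun=> u c)
    = hyp_int (biharm (u c) (u c)).
  rewrite /form_biharmonic lim_cst// (@riemann_integralE _ (biharm (u c) (u c)))//.
    exact: smooth_biharm.
  by move=> x Hx; exact: biharmE.
rewrite ler_pdivrMr ?L2pos//; apply: le_trans (neg c) _.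
rewrite !mulNr lerN2 -mulrA ler_pM2l//.
by rewrite mulrC ler_pdivrMr// mulrC.
Qed.

End bounded_domain.

(** * Dimension at least three *)

Section dimension_ge3.
Context {R : realType} {n : nat}.
Local Notation E := 'rV[R]_n.+1.
Local Notation H := (@halfspace R n).
Let oH := @open_halfspace R n.

(** Indicator of the horizontal coordinates; weighting sums over all the
    coordinates by it avoids splitting the index type. *)
Definition horiz (i : 'I_n.+1) : R := 1 - vert i.

Lemma vert_max : vert (ord_max : 'I_n.+1) = 1 :> R.
Proof. exact: kronii. Qed.

Lemma vert_widen (i : 'I_n) : vert (widen_ord (leqnSn n) i) = 0 :> R.
Proof.
rewrite /vert /kron (_ : (_ == _) = false)//.
by apply/eqP => /(congr1 val) /= h; have := ltn_ord i; rewrite h ltnn.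
Qed.

Lemma vert_eq0 (i : 'I_n.+1) : i != ord_max -> vert i = 0 :> R.
Proof. by rewrite /vert /kron => /negPf ->. Qed.

Lemma sum_vertl (F : 'I_n.+1 -> R) : \sum_i vert i * F i = F ord_max.
Proof. by under eq_bigr do rewrite /vert kronC; rewrite sum_kron. Qed.

Lemma sum_vert1 : \sum_(i < n.+1) vert i = 1 :> R.
Proof. by under eq_bigr do rewrite -[vert _]mulr1; rewrite sum_vertl. Qed.

Lemma horiz_ge0 i : 0 <= horiz i.
Proof.
rewrite /horiz; have [->|iM] := eqVneq i ord_max.
  by rewrite vert_max subrr.
by rewrite vert_eq0// subr0 ler01.
Qed.

Lemma horiz_idem i : horiz i * horiz i = horiz i.
Proof.
rewrite /horiz; have [->|iM] := eqVneq i ord_max.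
  by rewrite vert_max; ring.
by rewrite vert_eq0//; ring.
Qed.

Lemma kron_vert (i j : 'I_n.+1) : kron i j * vert j = vert i * vert j :> R.
Proof.
rewrite /kron; have [->|ij] := eqVneq i j.
  by rewrite mul1r /vert /kron; case: eqP; rewrite ?mulr1 ?mulr0.
rewrite mul0r /vert /kron; case: eqP => [ei|]; last by rewrite mul0r.
by case: eqP => [ej|]; rewrite ?mulr0//; move: ij; rewrite ei ej eqxx.
Qed.

Definition horiz_norm2 (x : E) : R := \sum_j horiz j * (x 0 j * x 0 j).

Lemma smooth_horiz_norm2 : smooth H horiz_norm2.
Proof.
apply: (smooth_sum oH) => j; apply: (smoothM oH (smooth_cst oH _)).
by apply: (smoothM oH); exact: (smooth_coord oH).
Qed.

Lemma has_partials_horiz_norm2 :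
  has_partials H horiz_norm2 (fun i x => 2 * horiz i * x 0 i).
Proof.
move=> x Hx i; apply: is_derive_eq.
  exact: (has_partials_lincomb _ (fun j => has_partialsM
    (@has_partials_coord _ _ H j) (@has_partials_coord _ _ H j)) Hx i).
rewrite (eq_bigr (fun j => kron i j * (2 * horiz j * x 0 j))) ?sum_kron//.
by move=> j _; rewrite -/(kron i j); ring.
Qed.

Definition horiz_lin (c : E) (x : E) : R := \sum_j horiz j * c 0 j * x 0 j.

Lemma has_partials_horiz_lin c :
  has_partials H (horiz_lin c) (fun i _ => horiz i * c 0 i).
Proof.
move=> x Hx i; apply: is_derive_eq.
  exact: (has_partials_lincomb _ (fun j => @has_partials_coord _ _ H j) Hx i).
rewrite (eq_bigr (fun j => kron i j * (horiz j * c 0 j))) ?sum_kron//.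
by move=> j _; rewrite mulrC.
Qed.

Variable eps : R.

(** For the density, the pairing of x_i with x_i / y is - n y, and that of ln y with
    |x|^2 is - 2 n y^2: both perturbations decrease the energy to first order. *)
Definition trial_fn (i : 'I_n.+1) (x : E) : R :=
  if i == ord_max then ln (height x) + eps * horiz_norm2 x
  else x 0 i * (1 + eps * inv_height x).

Lemma smooth_trial_fn i : smooth H (trial_fn i).
Proof.
rewrite /trial_fn; case: eqP => _.
  apply: (smoothD oH); first exact: smooth_ln_height.
  by apply: (smoothM oH (smooth_cst oH _)); exact: smooth_horiz_norm2.
apply: (smoothM oH); first exact: (smooth_coord oH).
apply: (smoothD oH (smooth_cst oH _)).
by apply: (smoothM oH (smooth_cst oH _)); exact: smooth_inv_height.
Qed.

Lemma trial_fn_lincomb (c : E) :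
  (fun x => \sum_i c 0 i * trial_fn i x) =
  (fun x => horiz_lin c x * (1 + eps * inv_height x)
            + c 0 ord_max * (ln (height x) + eps * horiz_norm2 x)).
Proof.
apply/funext => x; rewrite big_ord_recr /= {2}/trial_fn eqxx; congr (_ + _).
rewrite /horiz_lin big_ord_recr /= /horiz vert_max subrr !mul0r addr0 mulr_suml.
apply: eq_bigr => i _; rewrite vert_widen subr0 mul1r /trial_fn ifF ?mulrA//.
by apply/eqP => /(congr1 val) /= h; have := ltn_ord i; rewrite h ltnn.
Qed.

Section combination.
Variable c : E.
Let b := c 0 ord_max.
Let u (x : E) := horiz_lin c x * (1 + eps * inv_height x)
  + b * (ln (height x) + eps * horiz_norm2 x).

Lemma partial_trial_fn : has_partials H u (fun i x =>
  horiz i * c 0 i + eps * horiz i * c 0 i * inv_height x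
  - eps * vert i * horiz_lin c x * inv_height x ^+ 2
  + b * vert i * inv_height x + 2 * b * eps * horiz i * x 0 i).
Proof.
move=> x Hx i; apply: is_derive_eq.
  exact: (has_partialsD
    (has_partialsM (has_partials_horiz_lin c)
       (has_partialsD (@has_partials_cst _ _ H 1)
          (has_partialsZ eps has_partials_inv_height)))
    (has_partialsZ b (has_partialsD has_partials_ln_height
       (has_partialsZ eps has_partials_horiz_norm2))) Hx i).
cbv beta; ring.
Qed.

Lemma partial2_trial_fn i j x : H x -> partial i (partial j u) x =
  - eps * horiz j * c 0 j * inv_height x ^+ 2 * vert i
  - eps * vert j * (horiz i * c 0 i * inv_height x ^+ 2
      - 2 * horiz_lin c x * inv_height x ^+ 3 * vert i)
  - b * vert j * inv_height x ^+ 2 * vert i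
  + 2 * b * eps * horiz j * kron i j.
Proof.
move=> Hx.
pose G (x : E) := horiz j * c 0 j + (eps * horiz j * c 0 j) * inv_height x
  + (- eps * vert j) * (horiz_lin c x * (inv_height x * inv_height x))
  + (b * vert j) * inv_height x + (2 * b * eps * horiz j) * x 0 j.
rewrite (partial_ext oH (g := G) i _ Hx); last first.
  by move=> y Hy; rewrite (has_partialsE j partial_trial_fn Hy) /G; ring.
have PG := has_partialsD (has_partialsD (has_partialsD (has_partialsD
  (@has_partials_cst _ _ H (horiz j * c 0 j))
  (has_partialsZ (eps * horiz j * c 0 j) has_partials_inv_height))
  (has_partialsZ (- eps * vert j) (has_partialsM (has_partials_horiz_lin c)
    (has_partialsM has_partials_inv_height has_partials_inv_height))))
  (has_partialsZ (b * vert j) has_partials_inv_height))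
  (has_partialsZ (2 * b * eps * horiz j) (@has_partials_coord _ _ H j)).
by rewrite (has_partialsE i PG Hx) -/(kron i j); ring.
Qed.

Let D (x : E) i := (c 0 i + 2 * b * eps * x 0 i) * height x.

Lemma frame_grad_trial_fn x i : H x -> frame_grad u x i =
  horiz i * (D x i + eps * c 0 i) + vert i * (b - eps * horiz_lin c x * inv_height x).
Proof.
move=> Hx; rewrite /frame_grad (has_partialsE i partial_trial_fn Hx) /D /inv_height.
have := height_neq0 Hx; move: (height x) => y y0; by field.
Qed.

Lemma frame_hess_trial_fn x i j : H x -> frame_hess u x i j =
  vert i * vert j * (eps * horiz_lin c x * inv_height x)
  + horiz j * vert i * D x j + horiz i * vert j * D x i
  + (kron i j - vert i * vert j)
     * (2 * b * eps * height x ^+ 2 + eps * horiz_lin c x * inv_height x - b).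
Proof.
move=> Hx; rewrite /frame_hess partial2_trial_fn// !(has_partialsE _ partial_trial_fn Hx).
rewrite /horiz vert_max.
have h : kron i j * (1 - vert j) = kron i j - vert i * vert j :> R.
  by rewrite mulrBr mulr1 kron_vert.
rewrite -[2 * b * eps * _ * _]mulrA [(1 - vert j) * kron i j]mulrC h.
rewrite /D /inv_height; have := height_neq0 Hx; move: (height x) => y y0; by field.
Qed.

(** The vertical, mixed and horizontal diagonal parts of [frame_hess_trial_fn] sit
    in different entries, so the squares have no cross terms. *)
Lemma sum_frame_hess_trial_fn x : H x ->
  \sum_i \sum_j frame_hess u x i j * frame_hess u x i j =
  n%:R * (2 * b * eps * height x ^+ 2 + eps * horiz_lin c x * inv_height x - b) ^+ 2
  + 2 * (\sum_i horiz i * D x i ^+ 2) + (eps * horiz_lin c x * inv_height x) ^+ 2.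
Proof.
move=> Hx; set e := eps * horiz_lin c x * inv_height x.
set A := 2 * b * eps * _ + e - b.
set S := \sum_i horiz i * _.
have sq i j : frame_hess u x i j * frame_hess u x i j =
    vert j * (vert i * (e ^+ 2 - A ^+ 2)
    + horiz i * D x i ^+ 2) + horiz j * D x j ^+ 2 * vert i + kron i j * A ^+ 2.
  rewrite frame_hess_trial_fn// -/e -/A /horiz.
  have [->|iM] := eqVneq i ord_max; have [->|jM] := eqVneq j ord_max.
  - by rewrite kronii vert_max; ring.
  - by rewrite vert_max [kron _ _]kronC -/(vert j) vert_eq0//; ring.
  - by rewrite vert_max -/(vert i) vert_eq0//; ring.
  - rewrite !vert_eq0//; have [->|ij] := eqVneq i j; first by rewrite kronii; ring.
    by have -> : kron i j = 0 :> R; [rewrite /kron (negPf ij)|ring].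
under eq_bigr do under eq_bigr do rewrite sq.
under eq_bigr do rewrite !big_split /= sum_vertl -mulr_suml sum_kron -/S.
rewrite !big_split /= sum_vertl -mulr_sumr sum_vert1 -/S sumr_const card_ord.
rewrite -[_ *+ n.+1]mulr_natl -natr1; ring.
Qed.

Lemma biharm_trial_fn x : H x ->
  biharm u u x =
  n%:R * (2 * b * eps * height x ^+ 2 + eps * horiz_lin c x * inv_height x - b) ^+ 2
  + 2 * (\sum_i horiz i * D x i ^+ 2) + (eps * horiz_lin c x * inv_height x) ^+ 2
  - n%:R * (\sum_i horiz i * (D x i + eps * c 0 i) ^+ 2
            + (b - eps * horiz_lin c x * inv_height x) ^+ 2).
Proof.
move=> Hx; rewrite /biharm sum_frame_hess_trial_fn//; congr (_ - _ * _).
set e := eps * horiz_lin c x * inv_height x.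
rewrite (eq_bigr (fun i => horiz i * (D x i + eps * c 0 i) ^+ 2
  + vert i * (b - e) ^+ 2)).
  by rewrite big_split /= sum_vertl.
move=> i _; rewrite frame_grad_trial_fn// -/e /horiz.
have [->|iM] := eqVneq i ord_max; first by rewrite vert_max; ring.
by rewrite vert_eq0//; ring.
Qed.

Let C := \sum_i horiz i * c 0 i ^+ 2.

(** Cauchy-Schwarz, the weights being idempotent. *)
Lemma horiz_lin_sqr_le x : horiz_lin c x ^+ 2 <= C * horiz_norm2 x.
Proof.
have := cauchy_schwarz_sum (fun i => horiz i * c 0 i) (fun i => horiz i * x 0 i).
rewrite [X in X ^+ 2](_ : _ = horiz_lin c x); last first.
  by apply: eq_bigr => i _; rewrite -{3}(horiz_idem i); ring.
rewrite [X in X * _](_ : _ = C); last first.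
  by apply: eq_bigr => i _; rewrite exprMn expr2 horiz_idem.
rewrite [X in _ * X](_ : _ = horiz_norm2 x)//.
by apply: eq_bigr => i _; rewrite -{3}(horiz_idem i); ring.
Qed.

(** The terms of order 0 in eps cancel when n = 2 and are nonpositive when n > 2,
    those of order 1 are the negative ones, and the error is quadratic in eps.
    Here n is the number of horizontal coordinates, and 2 <= n is used to compare
    2 |D|^2 with n |D + eps c|^2. *)
Lemma biharm_trial_fn_le x : (1 < n)%N -> 0 <= eps -> H x ->
  biharm u u x <= - (4 * eps) * (n%:R * b ^+ 2 * height x ^+ 2 + height x * C)
   + eps ^+ 2 * ((horiz_lin c x * inv_height x) ^+ 2
       + 4 * (n%:R - 2) * b * horiz_lin c x * height x
       + 4 * n%:R * b ^+ 2 * height x ^+ 4).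
Proof.
move=> n1 e0 Hx; rewrite biharm_trial_fn//.
set S1 := \sum_i _ * _; set S2 := \sum_i horiz i * (_ + _) ^+ 2.
have S2E : S2 = S1 + 2 * eps * (height x * C + 2 * b * eps * height x * horiz_lin c x)
    + eps ^+ 2 * C.
  rewrite /S2 /S1 /C /horiz_lin !mulr_sumr -!big_split /= mulr_sumr -!big_split /=.
  by apply: eq_bigr => i _; rewrite /D; ring.
have S20 : 0 <= S2 by apply: sumr_ge0 => i _; rewrite mulr_ge0 ?horiz_ge0 ?sqr_ge0.
have C0 : 0 <= C by apply: sumr_ge0 => i _; rewrite mulr_ge0 ?horiz_ge0 ?sqr_ge0.
have n2 : 0 <= n%:R - 2 :> R by rewrite subr_ge0 ler_nat.
have h1 : 0 <= (n%:R - 2) * S2 by exact: mulr_ge0.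
have h2 : 0 <= eps ^+ 2 * C by rewrite mulr_ge0 ?horiz_ge0 ?sqr_ge0.
have hy : inv_height x * height x = 1 by rewrite mulVf// height_neq0.
rewrite -subr_ge0 [leRHS](_ : _ = (n%:R - 2) * S2 + 2 * (eps ^+ 2 * C)).
  by rewrite addr_ge0// mulr_ge0.
rewrite S2E.
move: hy; rewrite /inv_height; have := height_neq0 Hx.
move: (height x) => y y0 _; by field.
Qed.

End combination.

End dimension_ge3.

(** With N the squared norm of the coefficients, the negative part of the bound
    [biharm_trial_fn_le] is at most - 4 eps k^2 N, where k <= 1 is a lower bound
    of the height, and the error at most eps^2 B N. Hence eps = k^2 / (B + 1)
    leaves - 3 eps k^2 N. *)
Lemma mu_lt0_ge3 (R : realType) (n : nat) (Omega : set 'rV[R]_n.+1) :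
  (1 < n)%N -> Omega `<=` @halfspace R n -> open Omega -> hyp_bounded Omega ->
  Omega !=set0 -> (mu hyp_metric Omega n.+1 < 0)%E.
Proof.
move=> n1 OH oO bO O0.
have oH := @open_halfspace R n.
have [m [M [L [m0 box]]]] := Omega_box OH bO O0.
have [_ [P hP]] := smooth_tame OH bO O0 (@smooth_horiz_norm2 R n).
have [_ [h hh]] := smooth_tame OH bO O0 (@smooth_inv_height R n).
have [x0 Ox0] := O0.
have P0 : 0 <= P by apply: le_trans (hP _ Ox0).
have h0 : 0 <= h by apply: le_trans (hh _ Ox0).
have M0 : 0 <= M.
  by have [a yM _] := box _ Ox0; exact: le_trans (ltW m0) (le_trans a yM).
pose k := Num.min m 1.
have k0 : 0 < k by rewrite lt_min m0 ltr01.
have k1 : k <= 1 by rewrite ge_min lexx orbT.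
have km : k <= m by rewrite ge_min lexx.
pose B := P * h ^+ 2 + 2 * n%:R * M * (1 + P) + 4 * n%:R * M ^+ 4.
have B0 : 0 <= B.
  by rewrite /B !addr_ge0// ?mulr_ge0// ?addr_ge0// ?sqr_ge0// ?exprn_ge0.
pose eps := k ^+ 2 / (B + 1).
have e0 : 0 < eps by rewrite divr_gt0 ?exprn_gt0// ltr_wpDl.
have eB : eps * B <= k ^+ 2.
  rewrite /eps mulrAC ler_pdivrMr ?ltr_wpDl// ler_pM2l ?exprn_gt0//.
  by rewrite lerDl.
have C1 : smooth (@halfspace R n) (fun=> 1 : R) by exact: (smooth_cst oH).
have V0 : 0 < hyp_int Omega (fun=> 1).
  exact: (hyp_int_gt0 OH oO bO O0 C1 (fun _ _ => ler01) Ox0 ltr01).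
apply: (mu_lt0 OH oO bO O0 (smooth_trial_fn eps)
  (kappa := 3 * eps * k ^+ 2 * hyp_int Omega (fun=> 1))).
  by apply: mulr_gt0 => //; apply: mulr_gt0; [exact: mulr_gt0|exact: exprn_gt0].
move=> c; rewrite trial_fn_lincomb /=; set u := (fun x => _).
have Cu : smooth (@halfspace R n) u.
  rewrite /u -trial_fn_lincomb; apply: (smooth_sum oH) => i.
  by apply: (smoothM oH (smooth_cst oH _)); exact: smooth_trial_fn.
set N := \sum_i c 0 i ^+ 2.
pose C := \sum_i horiz i * c 0 i ^+ 2.
pose b := c 0 ord_max.
have NE : N = C + b ^+ 2.
  rewrite /N /C -(sum_vertl (fun i => c 0 i ^+ 2)) -big_split /=.
  by apply: eq_bigr => i _; rewrite /horiz; ring.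
have HC0 : 0 <= C by apply: sumr_ge0 => i _; rewrite mulr_ge0 ?horiz_ge0 ?sqr_ge0.
have b20 : 0 <= b ^+ 2 by exact: sqr_ge0.
rewrite [leRHS](_ : _ = hyp_int Omega (fun x => - (3 * eps * k ^+ 2 * N) * 1)).
  apply: (le_hyp_int OH oO bO O0).
  - exact: smooth_biharm.
  - exact: (smoothM oH (smooth_cst oH _) C1).
  move=> x Ox; have Hx := OH _ Ox.
  apply: le_trans (biharm_trial_fn_le _ n1 (ltW e0) Hx) _.
  rewrite -/b -/C.
  have [ym yM _] := box _ Ox.
  have p2 : horiz_lin c x ^+ 2 <= C * P.
    apply: le_trans (horiz_lin_sqr_le c x) _.
    by rewrite ler_wpM2l// (le_trans (ler_norm _) (hP _ Ox)).
  have h2 : inv_height x ^+ 2 <= h ^+ 2.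
    by rewrite -real_normK ?num_real// lerXn2r ?nnegrE ?(le_trans _ (hh _ Ox)) ?hh.
  move: p2 h2; move: (inv_height x) (horiz_lin c x) => hx p p2 h2.
  move: ym yM Hx; rewrite /halfspace /=; move: (height x) => y ym yM y0.
  (* the three error terms of order eps ^+ 2, each at most a multiple of N *)
  have t1 : (p * hx) ^+ 2 <= N * (P * h ^+ 2).
    rewrite exprMn mulrA; apply: ler_pM => //; rewrite ?sqr_ge0//.
    by apply: le_trans p2 _; rewrite ler_wpM2r// NE lerDl.
  have n0 : 0 <= n%:R :> R by [].
  have n2 : 2 <= n%:R :> R by rewrite ler_nat.
  have bp : 2 * (b * p) <= N * (1 + P).
    have := sqr_ge0 (b - p); rewrite sqrrB => bp0.
    have : b ^+ 2 + p ^+ 2 <= N * (1 + P).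
      rewrite mulrDr mulr1 lerD//; first by rewrite NE lerDr.
      by apply: le_trans p2 _; rewrite ler_wpM2r// NE lerDl.
    by apply: le_trans; lra.
  have NP0 : 0 <= N * (1 + P) by rewrite mulr_ge0 ?addr_ge0// NE addr_ge0.
  have t2 : 4 * (n%:R - 2) * b * p * y <= N * (2 * n%:R * M * (1 + P)).
    rewrite [leLHS](_ : _ = 2 * (n%:R - 2) * y * (2 * (b * p))); last by ring.
    rewrite [leRHS](_ : _ = 2 * n%:R * M * (N * (1 + P))); last by ring.
    apply: (@le_trans _ _ (2 * (n%:R - 2) * y * (N * (1 + P)))).
      by rewrite ler_wpM2l// !mulr_ge0// ?subr_ge0// ltW.
    rewrite ler_wpM2r// -!mulrA ler_pM2l//; apply: ler_pM => //.
    - by rewrite subr_ge0.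
    - exact: ltW.
    - by rewrite gerBl.
  have t3 : 4 * n%:R * b ^+ 2 * y ^+ 4 <= N * (4 * n%:R * M ^+ 4).
    rewrite [leLHS](_ : _ = b ^+ 2 * (4 * n%:R * y ^+ 4)); last by ring.
    apply: ler_pM => //; rewrite ?mulr_ge0// ?exprn_ge0 ?(ltW y0)//.
      by rewrite NE lerDr.
    by rewrite ler_wpM2l ?mulr_ge0// lerXn2r// nnegrE ltW.
  have yk : k <= y by exact: le_trans ym.
  have t4 : k ^+ 2 * N <= n%:R * b ^+ 2 * y ^+ 2 + y * C.
    rewrite NE mulrDr addrC; apply: lerD.
      rewrite [leLHS]mulrC; apply: ler_pM => //; first exact: sqr_ge0.
        by rewrite ler_peMl// (le_trans _ n2)// ler1n.
      by rewrite lerXn2r// nnegrE ltW.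
    by rewrite ler_wpM2r//; apply: le_trans yk; rewrite expr2 ler_piMr// ltW.
  have N0 : 0 <= N by rewrite NE addr_ge0.
  rewrite mulr1.
  have t5 : eps ^+ 2 * (N * B) <= eps * (k ^+ 2 * N).
    rewrite expr2 -mulrA ler_wpM2l ?(ltW e0)// [N * B]mulrC mulrA.
    by rewrite ler_wpM2r.
  have t6 : eps ^+ 2 * ((p * hx) ^+ 2 + 4 * (n%:R - 2) * b * p * y
       + 4 * n%:R * b ^+ 2 * y ^+ 4) <= eps ^+ 2 * (N * B).
    rewrite ler_wpM2l ?sqr_ge0//.
    apply: (@le_trans _ _ (N * (P * h ^+ 2) + N * (2 * n%:R * M * (1 + P))
      + N * (4 * n%:R * M ^+ 4))); first by apply: lerD t3; exact: lerD.
    by rewrite /B -!mulrDr.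
  have t7 : eps * (k ^+ 2 * N) <= eps * (n%:R * b ^+ 2 * y ^+ 2 + y * C).
    by rewrite ler_wpM2l// ltW.
  apply: (@le_trans _ _ (- (4 * eps) * (n%:R * b ^+ 2 * y ^+ 2 + y * C)
     + eps * (k ^+ 2 * N))); first by rewrite lerD2l (le_trans t6).
  move: t7; set X := n%:R * _ * _ + _ => t7.
  rewrite [leRHS](_ : _ = - 3 * (eps * (k ^+ 2 * N))); last by ring.
  rewrite [X in X + _](_ : _ = - 4 * (eps * X)); last by ring.
  lra.
rewrite hyp_intZ// mulNr mulNr; congr (- _); ring.
Qed.

(** * Signed distance to a geodesic of the hyperbolic plane *)

Section composition.
Context {R : realType} {n : nat}.
Local Notation E := 'rV[R]_n.+1.
Local Notation H := (@halfspace R n).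
Let oH := @open_halfspace R n.
Variables (phi dphi ddphi : R -> R).
Hypothesis phiE : forall t : R, is_derive t 1 phi (dphi t).
Hypothesis dphiE : forall t : R, is_derive t 1 dphi (ddphi t).

Lemma frame_grad_comp (X : E -> R) x i : smooth H X -> H x ->
  frame_grad (fun y => phi (X y)) x i = dphi (X x) * frame_grad X x i.
Proof.
move=> CX Hx; rewrite /frame_grad.
rewrite (has_partialsE i (has_partials_comp (fun y _ => phiE (X y))
  (smooth_partials CX)) Hx); ring.
Qed.

Lemma frame_hess_comp (X : E -> R) x i j : smooth H X -> H x ->
  frame_hess (fun y => phi (X y)) x i j =
  dphi (X x) * frame_hess X x i j + ddphi (X x) * frame_grad X x i * frame_grad X x j.
Proof.
move=> CX Hx; rewrite /frame_hess /frame_grad.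
have P1 y k : H y ->
    partial k (fun y => phi (X y)) y = dphi (X y) * partial k X y.
  by move=> Hy; rewrite (has_partialsE k (has_partials_comp
    (fun y _ => phiE (X y)) (smooth_partials CX)) Hy).
rewrite (partial_ext oH i (fun y Hy => P1 y j Hy) Hx) !P1//.
rewrite (has_partialsE i (has_partialsM (has_partials_comp
  (fun y _ => dphiE (X y)) (smooth_partials CX))
  (smooth_partials (smooth_partial j CX))) Hx); ring.
Qed.

End composition.

Section arsinh.
Context {R : realType}.
Implicit Types t : R.

Definition arsinh t : R := ln (t + Num.sqrt (1 + t ^+ 2)).

Definition darsinh t : R := (Num.sqrt (1 + t ^+ 2))^-1.

Lemma sqr1D_gt0 t : 0 < 1 + t ^+ 2.
Proof. by rewrite ltr_pwDl// sqr_ge0. Qed.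

Lemma darsinh_gt0 t : 0 < darsinh t.
Proof. by rewrite invr_gt0 sqrtr_gt0 sqr1D_gt0. Qed.

Lemma darsinh_sqr t : darsinh t ^+ 2 * (1 + t ^+ 2) = 1.
Proof.
rewrite /darsinh exprVn sqr_sqrtr; last exact: ltW (sqr1D_gt0 t).
by rewrite mulVf// gt_eqF// sqr1D_gt0.
Qed.

Lemma is_derive_sqrt1D t :
  is_derive t 1 (fun u : R => Num.sqrt (1 + u ^+ 2)) (t * darsinh t).
Proof.
have h : is_derive t 1 (fun u : R => 1 + u ^+ 2) (2 * t).
  have := is_deriveD (is_derive_cst (1 : R) t 1)
    (is_deriveX 2 (is_derive_id t (1 : R))).
  by move=> h; apply: is_derive_eq h _; rewrite /GRing.scale /= add0r expr1 mulr1.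
have := @is_derive1_comp R Num.sqrt (fun u => 1 + u ^+ 2) t _ _
  (is_derive1_sqrt (sqr1D_gt0 t)) h.
move=> h'; apply: is_derive_eq h' _; rewrite /darsinh.
have s0 : Num.sqrt (1 + t ^+ 2) != 0.
  by rewrite gt_eqF// sqrtr_gt0 sqr1D_gt0.
by move: (Num.sqrt _) s0 => s s0; field.
Qed.

(** The square root exceeds |t|. *)
Lemma arsinh_arg_gt0 t : 0 < t + Num.sqrt (1 + t ^+ 2).
Proof.
rewrite -ltrBlDl sub0r; apply: le_lt_trans (ler_norm _) _.
rewrite normrN -sqrtr_sqr ltr_sqrt; last exact: sqr1D_gt0.
by rewrite ltrDr.
Qed.

Lemma is_derive_arsinh t : is_derive t 1 arsinh (darsinh t).
Proof.
have h := is_deriveD (is_derive_id t (1 : R)) (is_derive_sqrt1D t).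
have := @is_derive1_comp R (@ln R) (fun u => u + Num.sqrt (1 + u ^+ 2)) t _ _
  (is_derive1_ln (arsinh_arg_gt0 t)) h.
move=> h'; apply: is_derive_eq h' _.
have p0 := arsinh_arg_gt0 t; rewrite /darsinh.
have s0 : Num.sqrt (1 + t ^+ 2) != 0.
  by rewrite gt_eqF// sqrtr_gt0 sqr1D_gt0.
move: (Num.sqrt _) s0 p0 => s s0 p0; field.
by rewrite s0 gt_eqF.
Qed.

Lemma is_derive_darsinh t : is_derive t 1 darsinh (- t * darsinh t ^+ 3).
Proof.
have s0 : Num.sqrt (1 + t ^+ 2) != 0.
  by rewrite gt_eqF// sqrtr_gt0 sqr1D_gt0.
have := @is_deriveV R (fun u => Num.sqrt (1 + u ^+ 2)) t _ 1 s0
  (is_derive_sqrt1D t).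
move=> h'; apply: is_derive_eq h' _; rewrite /GRing.scale /= /darsinh.
by move: (Num.sqrt _) s0 => s s0; field.
Qed.

End arsinh.

Section arsinh_smooth.
Context {R : realType} {n : nat}.
Local Notation E := 'rV[R]_n.+1.
Local Notation H := (@halfspace R n).
Let oH := @open_halfspace R n.

Lemma smooth_arsinh (X : E -> R) : smooth H X ->
  smooth H (fun x => arsinh (X x)).
Proof.
move=> CX.
have CW : smooth H (fun x => darsinh (X x)).
  apply: (@smooth_riccati _ _ _ oH _ 3 (fun i x => - X x * partial i X x)).
  - exact: (cont_on_comp (dphi := fun t => - t * darsinh t ^+ 3)
      (fun x _ => is_derive_darsinh (X x)) (smooth_cont CX)).
  - move=> i; apply: (smoothM oH); first exact: (smoothN oH).
    exact: (smooth_partial i CX).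
  - move=> x Hx i; apply: is_derive_eq.
      exact: (has_partials_comp (dphi := fun t => - t * darsinh t ^+ 3)
        (fun x _ => is_derive_darsinh (X x)) (smooth_partials CX) Hx i).
    cbv beta; ring.
apply: (smoothI oH _ (has_partials_comp (fun x _ => is_derive_arsinh (X x))
        (smooth_partials CX))).
  exact: (cont_on_comp (fun x _ => is_derive_arsinh (X x)) (smooth_cont CX)).
by move=> i; apply: (smoothM oH) => //; exact: (smooth_partial i CX).
Qed.

End arsinh_smooth.

Section dimension2.
Context {R : realType}.
Local Notation E := 'rV[R]_2.
Local Notation H := (@halfspace R 1).
Let oH := @open_halfspace R 1.

Lemma sum2 (F : 'I_2 -> R) : \sum_i F i = F ord0 + F ord_max.
Proof.
rewrite !big_ord_recr big_ord0 /= add0r; congr (F _ + F _); exact: val_inj.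
Qed.

Lemma kron01 : kron (ord0 : 'I_2) ord_max = 0 :> R.
Proof. by []. Qed.

Variables a b : R.

(** The restriction to the half-plane of a linear function on Minkowski space,
    which vanishes on a geodesic through the point i. When a^2 + b^2 = 1 it is
    sinh of the signed distance to this geodesic. *)
Definition geodesic_fn (x : E) : R :=
  (a * x 0 ord0 + b / 2 * (x 0 ord0 ^+ 2 + height x ^+ 2 - 1)) * inv_height x.

Let num (x : E) : R :=
  a * x 0 ord0 + b / 2 * (x 0 ord0 * x 0 ord0 + height x * height x + -1).

Let geodesic_fn_num x : geodesic_fn x = num x * inv_height x.
Proof. by rewrite /geodesic_fn /num -!expr2. Qed.

Lemma smooth_geodesic_fn : smooth H geodesic_fn.
Proof.
have Cx := @smooth_coord R 2 H oH ord0; have Cy := @smooth_height R 1.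
have -> : geodesic_fn = (fun x => num x * inv_height x).
  by apply/funext => x; exact: geodesic_fn_num.
apply: (smoothM oH); last exact: smooth_inv_height.
apply: (smoothD oH); first exact: (smoothM oH (smooth_cst oH _)).
apply: (smoothM oH (smooth_cst oH _)).
apply: (smoothD oH); last exact: (smooth_cst oH).
by apply: (smoothD oH); apply: (smoothM oH).
Qed.

Lemma partial_geodesic_fn : has_partials H geodesic_fn (fun i x =>
  (a * kron i ord0 + b * (kron i ord0 * x 0 ord0 + vert i * height x)) * inv_height x
  - vert i * (geodesic_fn x * inv_height x)).
Proof.
move=> x Hx i.
have -> : geodesic_fn = (fun x => num x * inv_height x).
  by apply/funext => y; exact: geodesic_fn_num.
have Px := @has_partials_coord R 2 H ord0; have Py := @has_partials_height R 1.
apply: is_derive_eq.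
  exact: (has_partialsM (has_partialsD (has_partialsZ a Px)
    (has_partialsZ (b / 2) (has_partialsD (has_partialsD
       (has_partialsM Px Px) (has_partialsM Py Py))
       (@has_partials_cst _ _ H (-1))))) has_partials_inv_height Hx i).
by cbv beta; rewrite -/(kron i ord0) /num; field.
Qed.

Lemma frame_grad_geodesic_fn x i : H x -> frame_grad geodesic_fn x i =
  kron i ord0 * (a + b * x 0 ord0) + vert i * (b * height x - geodesic_fn x).
Proof.
move=> Hx; rewrite /frame_grad (has_partialsE i partial_geodesic_fn Hx) /inv_height.
have := height_neq0 Hx; move: (geodesic_fn x) (height x) => X y y0; by field.
Qed.

(** Linear functions X on Minkowski space satisfy D^2 X = X g on the hyperboloid. *)
Lemma frame_hess_geodesic_fn x i j : H x ->
  frame_hess geodesic_fn x i j = kron i j * geodesic_fn x.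
Proof.
move=> Hx; have Px := @has_partials_coord R 2 H ord0.
have Py := @has_partials_height R 1.
have PG := has_partialsD (has_partialsM
    (has_partialsD (@has_partials_cst _ _ H (a * kron j ord0))
       (has_partialsZ b (has_partialsD (has_partialsZ (kron j ord0) Px)
          (has_partialsZ (vert j) Py)))) has_partials_inv_height)
    (has_partialsZ (- vert j) (has_partialsM partial_geodesic_fn has_partials_inv_height)).
rewrite /frame_hess (partial_ext oH i _ Hx (g := fun x =>
  (a * kron j ord0 + b * (kron j ord0 * x 0 ord0 + vert j * height x)) * inv_height x
  + - vert j * (geodesic_fn x * inv_height x))); last first.
  by move=> y Hy; rewrite (has_partialsE j partial_geodesic_fn Hy) mulNr.
rewrite (has_partialsE i PG Hx) !(has_partialsE _ partial_geodesic_fn Hx).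
rewrite -/(kron i ord0) {PG Px Py}.
(* the two coordinate directions resolve the identity *)
have vE : kron i j = kron i ord0 * kron j ord0 + vert i * vert j :> R.
  by case: i => -[|[|//]] ?; case: j => -[|[|//]] ?; rewrite /vert /kron /=;
    rewrite ?mulr0 ?mulr1 ?addr0 ?add0r.
have v0 : kron (ord_max : 'I_2) ord0 = 0 :> R by [].
have v1 : vert (ord_max : 'I_2) = 1 :> R by exact: kronii.
rewrite vE v0 v1 /inv_height; have := height_neq0 Hx.
move: (geodesic_fn x) (height x) => X y y0.
move: (kron i ord0) (kron j ord0) (vert i) (vert j) => ki kj vi vj.
by field.
Qed.

End dimension2.

Section distance_to_geodesic.
Context {R : realType}.
Local Notation E := 'rV[R]_2.
Local Notation H := (@halfspace R 1).
Let oH := @open_halfspace R 1.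

Definition geodesic_dist (t : R) (x : E) : R :=
  arsinh (geodesic_fn (cos t) (sin t) x).

Lemma smooth_geodesic_dist t : smooth H (geodesic_dist t).
Proof. by apply: smooth_arsinh; exact: smooth_geodesic_fn. Qed.

(** The inner product of the tangential parts of two Minkowski vectors, at a point
    of norm -1. *)
Lemma frame_grad_geodesic_fn_dot (a1 b1 a2 b2 : R) (x : E) : H x ->
  \sum_i frame_grad (geodesic_fn a1 b1) x i * frame_grad (geodesic_fn a2 b2) x i =
  geodesic_fn a1 b1 x * geodesic_fn a2 b2 x + a1 * a2 + b1 * b2.
Proof.
move=> Hx; rewrite sum2 !frame_grad_geodesic_fn// /vert !kronii kron01 kronC kron01.
rewrite /geodesic_fn /inv_height; have := height_neq0 Hx.
by move: (height x) (x 0 ord0) => y z y0; field.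
Qed.

(** The cosine of the angle between the gradients of two distance functions. *)
Definition geodesic_cos (t1 t2 : R) (x : E) : R :=
  let X1 := geodesic_fn (cos t1) (sin t1) x in
  let X2 := geodesic_fn (cos t2) (sin t2) x in
  darsinh X1 * darsinh X2 * (X1 * X2 + cos (t1 - t2)).

(** With c the cosine of the angle between the gradients, the Hessians
    tanh s (g - ds^2) have inner product tanh s_1 tanh s_2 c^2 in dimension two. *)
Lemma biharm_geodesic_dist t1 t2 x : H x ->
  let X1 := geodesic_fn (cos t1) (sin t1) x in
  let X2 := geodesic_fn (cos t2) (sin t2) x in
  let c := geodesic_cos t1 t2 x in
  biharm (geodesic_dist t1) (geodesic_dist t2) x =
  X1 * X2 * darsinh X1 * darsinh X2 * c ^+ 2 - c.
Proof.
move=> Hx X1 X2 c; rewrite /biharm mul1r.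
have C1 := smooth_geodesic_fn (cos t1) (sin t1).
have C2 := smooth_geodesic_fn (cos t2) (sin t2).
have G11 := frame_grad_geodesic_fn_dot (cos t1) (sin t1) (cos t1) (sin t1) Hx.
have G12 := frame_grad_geodesic_fn_dot (cos t1) (sin t1) (cos t2) (sin t2) Hx.
have G22 := frame_grad_geodesic_fn_dot (cos t2) (sin t2) (cos t2) (sin t2) Hx.
have N1 := darsinh_sqr X1; have N2 := darsinh_sqr X2.
have cE : c = darsinh X1 * darsinh X2 *
    \sum_i frame_grad (geodesic_fn (cos t1) (sin t1)) x i *
           frame_grad (geodesic_fn (cos t2) (sin t2)) x i.
  by rewrite G12 /c /geodesic_cos cosB addrA.
have cs1 := cos2Dsin2 t1; have cs2 := cos2Dsin2 t2.
rewrite -/X1 -addrA -!expr2 cs1 addrC in G11.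
rewrite -/X2 -addrA -!expr2 cs2 addrC in G22.
rewrite -G11 in N1; rewrite -G22 in N2.
rewrite !sum2 !(frame_grad_comp is_derive_arsinh _ C1 Hx)
  !(frame_grad_comp is_derive_arsinh _ C2 Hx)
  !(frame_hess_comp is_derive_arsinh is_derive_darsinh _ _ C1 Hx)
  !(frame_hess_comp is_derive_arsinh is_derive_darsinh _ _ C2 Hx)
  !frame_hess_geodesic_fn// !kronii [kron ord_max ord0]kronC kron01 -/X1 -/X2.
rewrite cE !sum2; rewrite !sum2 in N1 N2.
move: N1 N2 {G11 G12 G22 cE C1 C2 c cs1 cs2}.
move: (frame_grad _ _ ord0) (frame_grad _ _ ord_max) => p1 q1.
move: (frame_grad _ _ ord0) (frame_grad _ _ ord_max) => p2 q2.
move: (darsinh X1) (darsinh X2) => w1 w2 N1 N2.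
(* N1 and N2 say that the gradients of the distances are unit vectors, so that
   the bracket, the inner product of the two projections orthogonal to them, is
   the square of their inner product *)
rewrite [LHS](_ : _ = X1 * X2 * w1 * w2 *
   (2 - w1 ^+ 2 * (p1 * p1 + q1 * q1) - w2 ^+ 2 * (p2 * p2 + q2 * q2)
    + (w1 * w2 * (p1 * p2 + q1 * q2)) ^+ 2) - w1 * w2 * (p1 * p2 + q1 * q2));
  last by ring.
by rewrite N1 N2; ring.
Qed.

(** Turning the normal by pi reverses the sign of the distance. *)
Lemma biharm_geodesic_dist_pi x : H x ->
  biharm (geodesic_dist 0) (geodesic_dist pi) x =
  - biharm (geodesic_dist 0) (geodesic_dist 0) x.
Proof.
move=> Hx; rewrite !biharm_geodesic_dist// /geodesic_cos.
rewrite sub0r subrr cosN cospi sinpi cos0 sin0.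
have -> : geodesic_fn (-1) 0 x = - geodesic_fn 1 0 x by rewrite /geodesic_fn; ring.
have -> : darsinh (- geodesic_fn 1 0 x) = darsinh (geodesic_fn 1 0 x).
  by rewrite /darsinh sqrrN.
ring.
Qed.

(** sinh^2 of the distance to the point i, bounded on Omega. *)
Definition radius2 (x : E) : R := geodesic_fn 1 0 x ^+ 2 + geodesic_fn 0 1 x ^+ 2.

(** With X_t = P cos t + Q sin t, polarization gives
    X_t1 X_t2 >= - (X_t1 - X_t2)^2 / 4 >= - (1 - cos (t1 - t2)) (P^2 + Q^2) / 2,
    which is small for close angles. *)
Lemma geodesic_fn_dot_gt0 t1 t2 x B : radius2 x <= B ->
  B / 2 < cos (t1 - t2) * (1 + B / 2) ->
  0 < geodesic_fn (cos t1) (sin t1) x * geodesic_fn (cos t2) (sin t2) x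
      + cos (t1 - t2).
Proof.
have XE t : geodesic_fn (cos t) (sin t) x =
    cos t * geodesic_fn 1 0 x + sin t * geodesic_fn 0 1 x.
  by rewrite /geodesic_fn; ring.
rewrite !XE /radius2; move: (geodesic_fn 1 0 x) (geodesic_fn 0 1 x) => P Q PQ.
have := cos_le1 (t1 - t2); rewrite cosB.
have := cos2Dsin2 t1; have := cos2Dsin2 t2.
move: (cos t1) (cos t2) (sin t1) (sin t2) => a1 a2 b1 b2 h2 h1 e1.
set eta := a1 * a2 + b1 * b2 => hB.
have d2 : (a1 - a2) ^+ 2 + (b1 - b2) ^+ 2 = 2 * (1 - eta).
  rewrite [LHS](_ : _ = (a1 ^+ 2 + b1 ^+ 2) + (a2 ^+ 2 + b2 ^+ 2) - 2 * eta);
    last by rewrite /eta; ring.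
  by rewrite h1 h2; ring.
have cs : ((a1 - a2) * P + (b1 - b2) * Q) ^+ 2 <= 2 * (1 - eta) * B.
  apply: (@le_trans _ _ (2 * (1 - eta) * (P ^+ 2 + Q ^+ 2))); last first.
    by rewrite ler_wpM2l// mulr_ge0// subr_ge0.
  rewrite -d2 -subr_ge0.
  rewrite [leRHS](_ : _ = ((a1 - a2) * Q - (b1 - b2) * P) ^+ 2); last by ring.
  exact: sqr_ge0.
have := sqr_ge0 ((a1 + a2) * P + (b1 + b2) * Q) => sq.
have -> : (a1 * P + b1 * Q) * (a2 * P + b2 * Q) =
  (((a1 + a2) * P + (b1 + b2) * Q) ^+ 2 - ((a1 - a2) * P + (b1 - b2) * Q) ^+ 2) / 4.
  by field.
lra.
Qed.

(** The density is c (tanh s_1 tanh s_2 c - 1) with 0 < c <= 1 and |tanh| < 1. *)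
Lemma biharm_geodesic_dist_lt0 t1 t2 x : H x ->
  0 < geodesic_fn (cos t1) (sin t1) x * geodesic_fn (cos t2) (sin t2) x
      + cos (t1 - t2) ->
  biharm (geodesic_dist t1) (geodesic_dist t2) x < 0.
Proof.
move=> Hx pos; rewrite biharm_geodesic_dist// /geodesic_cos.
have G11 := frame_grad_geodesic_fn_dot (cos t1) (sin t1) (cos t1) (sin t1) Hx.
have G12 := frame_grad_geodesic_fn_dot (cos t1) (sin t1) (cos t2) (sin t2) Hx.
have G22 := frame_grad_geodesic_fn_dot (cos t2) (sin t2) (cos t2) (sin t2) Hx.
rewrite -addrA -cosB !sum2 in G12.
rewrite -addrA -!expr2 cos2Dsin2 sum2 -!expr2 in G11.
rewrite -addrA -!expr2 cos2Dsin2 sum2 -!expr2 in G22.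
move: pos; rewrite -G12.
move: (geodesic_fn (cos t1) (sin t1) x) (geodesic_fn (cos t2) (sin t2) x)
  G11 G22 {G12} => X1 X2.
move: (frame_grad _ _ ord0) (frame_grad _ _ ord_max) => p1 q1.
move: (frame_grad _ _ ord0) (frame_grad _ _ ord_max) => p2 q2 G11 G22 pos.
have N1 := darsinh_sqr X1; have N2 := darsinh_sqr X2.
move: N1 N2 (darsinh_gt0 X1) (darsinh_gt0 X2).
move: (darsinh X1) (darsinh X2) => w1 w2 N1 N2 w10 w20.
set c := w1 * w2 * _; have c0 : 0 < c by rewrite !mulr_gt0.
have c1 : c <= 1.
  have g1 : w1 ^+ 2 * (p1 ^+ 2 + q1 ^+ 2) * (w2 ^+ 2 * (p2 ^+ 2 + q2 ^+ 2)) = 1.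
    by rewrite G11 G22 ![_ ^+ 2 + 1]addrC N1 N2 mulr1.
  rewrite -(@expr_le1 _ 2) ?(ltW c0)// -subr_ge0 -{1}g1.
  rewrite [leRHS](_ : _ = (w1 * w2 * (p1 * q2 - q1 * p2)) ^+ 2); last first.
    by rewrite /c; ring.
  exact: sqr_ge0.
clearbody c.
have xw (X w : R) : w ^+ 2 * (1 + X ^+ 2) = 1 -> 0 < w -> `|X * w| < 1.
  move=> N w0; rewrite -(ltr_pXn2r (n := 2))// ?nnegrE// real_normK ?num_real//.
  rewrite expr1n -N exprMn mulrC ltr_pM2l ?exprn_gt0//.
  by rewrite ltrDr.
rewrite expr2 mulrA subr_lt0 gtr_pMl//.
apply: le_lt_trans (ler_norm _) _.
have -> : X1 * X2 * w1 * w2 * c = (X1 * w1) * (X2 * w2) * c by ring.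
rewrite !normrM (gtr0_norm c0).
have := xw _ _ N1 w10; have := xw _ _ N2 w20; rewrite !normrM => a2 a1.
apply: (@le_lt_trans _ _ (`|X1| * `|w1| * (`|X2| * `|w2|))).
  by rewrite ler_piMr// !mulr_ge0.
by rewrite mulr_ilt1// mulr_ge0.
Qed.

End distance_to_geodesic.

(** * Dimension two *)

Lemma small_angle (R : realType) (a : R) : a < 1 ->
  exists m : nat, a < cos (pi / m.+1%:R).
Proof.
move=> a1.
have /nbhs_ballP[e /= e0 he] : nbhs (0 : R) [set t | a < cos t].
  have /cvgr_gt := @continuous_cos R 0; rewrite cos0; exact.
have [|m] := @ltr_add_invr R 0 (e / pi); first by rewrite divr_gt0// pi_gt0.
rewrite add0r ltr_pdivlMr ?pi_gt0// => hm; exists m; apply: he.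
rewrite /ball /= sub0r normrN gtr0_norm; last by rewrite divr_gt0// pi_gt0.
by rewrite mulrC.
Qed.

Lemma sign_change (R : realDomainType) (q : nat -> R) m :
  q 0%N <= 0 -> 0 < q m -> exists k, q k <= 0 /\ 0 < q k.+1.
Proof.
move=> q0; elim: m => [|m IH]; first by rewrite ltNge q0.
by move=> qm; have [qm0|/IH//] := leP (q m) 0; exists m.
Qed.

Section hyperbolic_form.
Context {R : realType} {n : nat} (Omega : set 'rV[R]_n.+1).
Local Notation E := 'rV[R]_n.+1.
Local Notation H := (@halfspace R n).
Hypothesis OmegaH : Omega `<=` H.
Hypothesis oOmega : open Omega.
Hypothesis bOmega : hyp_bounded Omega.
Hypothesis Omega0 : Omega !=set0.
Let oH := @open_halfspace R n.

(** The polarized energy on Omega. *)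
Definition hyp_form (f h : E -> R) : R := hyp_int Omega (biharm f h).

Lemma hyp_formC f h : hyp_form f h = hyp_form h f.
Proof. by apply: hyp_int_ext => x _; exact: biharmC. Qed.

Lemma hyp_form_lincomb m (c : 'I_m -> R) (e : 'I_m -> E -> R) h :
  (forall j, smooth H (e j)) -> smooth H h ->
  hyp_form (fun x => \sum_j c j * e j x) h = \sum_j c j * hyp_form (e j) h.
Proof.
move=> Ce Ch; rewrite /hyp_form.
rewrite (@hyp_int_ext _ _ _ _ (fun x => \sum_j c j * biharm (e j) h x)); last first.
  by move=> x /OmegaH; exact: biharm_lincomb.
have Cb j : smooth H (biharm (e j) h) by exact: smooth_biharm.
rewrite (hyp_int_sum OmegaH oOmega bOmega Omega0).
  by apply: eq_bigr => j _; rewrite (hyp_intZ OmegaH oOmega bOmega Omega0).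
by move=> j; apply: (smoothM oH (smooth_cst oH _)).
Qed.

Lemma hyp_form_lincomb2 a b f g h : smooth H f -> smooth H g -> smooth H h ->
  hyp_form (fun x => a * f x + b * g x) h = a * hyp_form f h + b * hyp_form g h.
Proof.
move=> Cf Cg Ch.
pose c (i : 'I_2) := if i == ord0 then a else b.
pose e (i : 'I_2) := if i == ord0 then f else g.
have -> : (fun x => a * f x + b * g x) = (fun x => \sum_i c i * e i x).
  by apply/funext => x; rewrite sum2.
rewrite hyp_form_lincomb ?sum2// => j.
by rewrite /e; case: ifP.
Qed.

Lemma hyp_int_lt0 F : smooth H F -> (forall x, Omega x -> F x < 0) ->
  hyp_int Omega F < 0.
Proof.
move=> CF F0; have [x0 Ox0] := Omega0.
have : 0 < hyp_int Omega (fun x => - 1 * F x).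
  apply: (hyp_int_gt0 OmegaH oOmega bOmega Omega0 (x := x0)) => //.
  - exact: (smoothM oH (smooth_cst oH _)).
  - by move=> y Oy; rewrite mulN1r oppr_ge0 ltW// F0.
  - by rewrite mulN1r oppr_gt0 F0.
by rewrite (hyp_intZ OmegaH oOmega bOmega Omega0)// mulN1r oppr_gt0.
Qed.

End hyperbolic_form.

(** The functions s k are distances to geodesics turned by steps of
    theta = pi / m.+1, small enough for consecutive ones to have negative mixed
    energy. As s m.+1 = - s 0, the mixed energy with s 0 changes sign between
    some s k and s k.+1. *)
Lemma mu_lt0_dim2 (R : realType) (Omega : set 'rV[R]_2) :
  Omega `<=` @halfspace R 1 -> open Omega -> hyp_bounded Omega ->
  Omega !=set0 -> (mu hyp_metric Omega 2 < 0)%E.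
Proof.
move=> OH oO bO O0.
have oH := @open_halfspace R 1.
have Cr : smooth (@halfspace R 1) radius2.
  by apply: (smoothD oH); apply: (smoothM oH); exact: smooth_geodesic_fn.
have [_ [B hB]] := smooth_tame OH bO O0 Cr.
have hB' x : Omega x -> radius2 x <= B.
  by move=> /hB; apply: le_trans; exact: ler_norm.
have B0 : 0 <= B by have [x /hB] := O0; apply: le_trans.
have [m hm] : exists m : nat, B / 2 < cos (pi / m.+1%:R) * (1 + B / 2).
  have d0 : 0 < 1 + B / 2 by rewrite ltr_pwDl// divr_ge0.
  have [|m hm] := @small_angle R (B / 2 / (1 + B / 2)).
    by rewrite ltr_pdivrMr// mul1r ltrDr.
  by exists m; rewrite -ltr_pdivrMr.
pose theta : R := pi / m.+1%:R.
pose s k := geodesic_dist (k%:R * theta).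
have Cs k : smooth (@halfspace R 1) (s k) by exact: smooth_geodesic_dist.
pose Q := hyp_form Omega.
have Qneg k l : cos (k%:R * theta - l%:R * theta) = cos theta \/ k = l ->
    Q (s k) (s l) < 0.
  move=> kl; apply: (hyp_int_lt0 OH oO bO O0); first exact: smooth_biharm.
  move=> x Ox; apply: (biharm_geodesic_dist_lt0 (OH _ Ox)).
  apply: (geodesic_fn_dot_gt0 (hB' _ Ox)).
  case: kl => [->//|->]; rewrite subrr cos0 mul1r.
  by rewrite ltrDr.
have [k [qk qk1]] : exists k, Q (s 0%N) (s k) <= 0 /\ 0 < Q (s 0%N) (s k.+1).
  apply: (@sign_change _ (fun k => Q (s 0%N) (s k)) m.+1).
    by apply: ltW; apply: Qneg; right.
  have -> : Q (s 0%N) (s m.+1) = -1 * Q (s 0%N) (s 0%N).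
    rewrite /Q /hyp_form -(hyp_intZ OH oO bO O0); last exact: smooth_biharm.
    apply: hyp_int_ext => x Ox; rewrite /s /theta mul0r mulrC divfK ?pnatr_eq0//.
    by rewrite biharm_geodesic_dist_pi ?mulN1r//; exact: OH.
  by rewrite mulN1r oppr_gt0; apply: Qneg; right.
(* the weights that make w orthogonal to s 0; both are nonnegative *)
pose al := Q (s 0%N) (s k.+1); pose be := - Q (s 0%N) (s k).
have al0 : 0 < al by [].
have be0 : 0 <= be by rewrite oppr_ge0.
pose w x := al * s k x + be * s k.+1 x.
have Cw : smooth (@halfspace R 1) w.
  by apply: (smoothD oH); apply: (smoothM oH (smooth_cst oH _)).
have Qlin a b f g h : smooth (@halfspace R 1) f -> smooth (@halfspace R 1) g ->
    smooth (@halfspace R 1) h ->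
    Q (fun x => a * f x + b * g x) h = a * Q f h + b * Q g h.
  by move=> *; apply: (hyp_form_lincomb2 OH oO bO O0).
have QC f g : Q f g = Q g f by exact: hyp_formC.
have Qw h : smooth (@halfspace R 1) h ->
    Q w h = al * Q (s k) h + be * Q (s k.+1) h by exact: Qlin.
have QE f g : Q f g = hyp_form Omega f g by [].
clearbody Q.
have Qw0 : Q w (s 0%N) = 0.
  rewrite Qw// [Q (s k) _]QC [Q (s k.+1) _]QC /be -/al.
  by rewrite mulNr mulrC subrr.
have Qww : Q w w < 0.
  rewrite Qw// [Q (s k) w]QC [Q (s k.+1) w]QC !Qw// [Q (s k) (s k.+1)]QC.
  have q1 := Qneg k k (or_intror erefl).
  have q2 := Qneg k.+1 k.+1 (or_intror erefl).
  have q3 : Q (s k.+1) (s k) < 0.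
    apply: Qneg; left; congr cos; rewrite -natr1; ring.
  move: (Q (s k) (s k)) (Q (s k.+1) (s k.+1)) (Q (s k.+1) (s k)) q1 q2 q3.
  move: al0 be0 {Qw Cw Qw0}; rewrite {}/w; move: al be.
  move=> al be al0 be0 x y z x0 y0 z0.
  have p1 : al * (al * x) < 0 by rewrite !pmulr_rlt0.
  have p2 : be * (be * y) <= 0 by rewrite !mulr_ge0_le0// ltW.
  have p3 : al * (be * z) <= 0 by rewrite !mulr_ge0_le0// ltW.
  lra.
have Q00 : Q (s 0%N) (s 0%N) < 0 by apply: Qneg; right.
pose e (i : 'I_2) := if i == ord0 then s 0%N else w.
have Ce i : smooth (@halfspace R 1) (e i) by rewrite /e; case: ifP.
pose kappa := Num.min (- Q (s 0%N) (s 0%N)) (- Q w w).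
have k0 : 0 < kappa by rewrite lt_min !oppr_gt0 Q00 Qww.
apply: (mu_lt0 OH oO bO O0 Ce k0) => c /=.
pose v x := c 0 ord0 * s 0%N x + c 0 ord_max * w x.
have -> : (fun x => \sum_i c 0 i * e i x) = v.
  by apply/funext => x; rewrite sum2.
have Cv : smooth (@halfspace R 1) v.
  by apply: (smoothD oH); apply: (smoothM oH (smooth_cst oH _)).
have Qv h : smooth (@halfspace R 1) h ->
    Q v h = c 0 ord0 * Q (s 0%N) h + c 0 ord_max * Q w h by exact: Qlin.
have -> : hyp_int Omega (biharm v v) = c 0 ord0 ^+ 2 * Q (s 0%N) (s 0%N)
     + c 0 ord_max ^+ 2 * Q w w.
  rewrite -/(hyp_form Omega v v) -QE Qv// [Q (s 0%N) v]QC [Q w v]QC !Qv//.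
  rewrite [Q (s 0%N) w]QC Qw0 !mulr0 addr0 add0r !mulrA.
  by rewrite !expr2.
rewrite sum2 mulNr mulrDr opprD; apply: lerD.
  rewrite -[leRHS]mulNr mulrC ler_wpM2r ?sqr_ge0// lerNr.
  by rewrite ge_min lexx.
rewrite -[leRHS]mulNr mulrC ler_wpM2r ?sqr_ge0// lerNr.
by rewrite ge_min lexx orbT.
Qed.

(** * Negative Neumann eigenvalues *)

Lemma mu_dim_lt0 (R : realType) (n : nat) (Omega : set 'rV[R]_n.+1) :
  (1 < n.+1)%N -> domain Omega -> hyp_bounded Omega ->
  (mu hyp_metric Omega n.+1 < 0)%E.
Proof.
move=> n1 [OH oO O0 _] bO; case: n n1 Omega OH oO O0 bO => [//|[|n]] _ Omega *.
  exact: mu_lt0_dim2.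
exact: mu_lt0_ge3.
Qed.

Theorem theorem4p6 (R : realType) (n : nat) (hn : (2 <= n.+1)%N)
  (Omega : set 'rV[R]_n.+1)
  (hdomain : domain Omega) (hbounded : hyp_bounded Omega)
  (hC1 : C1_boundary Omega) :
  [/\ (forall i j : nat, (0 < i)%N -> (i <= j)%N -> (j <= n.+1)%N ->
         (mu hyp_metric Omega i <= mu hyp_metric Omega j)%E),
      (mu hyp_metric Omega n.+1 < 0)%E
    & forall lambda : nat -> R, neumann_spectrum hyp_metric Omega lambda ->
        forall j : nat, (j < n.+1)%N -> lambda j < 0].
Proof.
have mu0 := mu_dim_lt0 hn hdomain hbounded.
split => // [i j _ ij _|lambda [_ _ lambda_mu] j jn]; first exact: mu_le.
by rewrite -lte_fin lambda_mu; apply: le_lt_trans mu0; exact: mu_le.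
Qed.
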